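(* Let $K$ be an algebraically closed field of characteristic $0$ and let $(r,s)\in\mathbb{Z}^2$ with $\nu=r+s>0$. The division rings $\widetilde D_{r,s}$ (defined when $s\neq 0$), $\check D_{r,s}$ (defined when $r\neq 0$) and $\widehat D_{r,s}$ all satisfy the commutative centralizer condition.
   Context: A noncommutative algebra $A$ satisfies the commutative centralizer condition (ccc) if the centralizer in $A$ of each element not in the center of $A$ is a commutative algebra. $\widetilde D_{r,s}$ ($s\ne 0$): let $\alpha$ be an indeterminate. $\widetilde D_{r,s}$ is the set of formal series $\sum_{i\le n}a_iT^i$ ($a_i\in K(\alpha)$, $n\in\mathbb{Z}$) with the usual addition and the multiplication $$\sum_{i\le m}a_iT^i\cdot\sum_{j\le n}b_jT^j=\sum_{i\le m,\,j\le n}\ \sum_{k\ge 0}\lambda_i^k\,a_i\,b_j^{(k)}\,T^{i+j-k\nu},$$ where $b^{(k)}$ is the $k$-th derivative, $\lambda_i^0=1$ and $\lambda_i^k=(\nu/s)^k\sum_{l=1}^k(-1)^{k-l}\binom{i}{l}\binom{i-l-1}{k-l}\binom{l\nu^{-1}}{k}$ for $k>0$ (with $\binom ak=a(a-1)\cdots(a-k+1)/k!$; the $k$ in $\lambda_i^k$ is an index). It is a division ring, complete for the degree map given by the largest exponent of $T$ occurring (metric $e^{\deg(f-g)}$). $\check D_{r,s}$ ($r\neq 0$): let $\beta$ be an indeterminate. $\check D_{r,s}$ is the set of formal series $\sum_{i\le n}T^ia_i$ ($a_i\in K(\beta)$, $n\in\mathbb{Z}$) with the usual addition and the multiplication $$\sum_{i\le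 m}T^ia_i\cdot\sum_{j\le n}T^jb_j=\sum_{i\le m,\,j\le n}\ \sum_{k\ge 0}\mu_j^k\,T^{i+j-k\nu}\,a_i^{(k)}\,b_j,$$ where $\mu_j^0=1$ and $\mu_j^k=(\nu/r)^k\sum_{l=1}^k(-1)^{k-l}\binom{j}{l}\binom{j-l-1}{k-l}\binom{l\nu^{-1}}{k}$ for $k>0$. It is a division ring, complete for the degree map given by the largest exponent of $T$. $\widehat D_{r,s}$: the Weyl algebra $A_1(K)$ is generated by $\mathbf p,\mathbf q$ with $\mathbf q\mathbf p-\mathbf p\mathbf q=1$, and $D_1(K)$ is its quotient division ring. $D_1(K)$ carries the degree map $\mathsf v_{r,s}$ determined by $\mathsf v_{r,s}(\sum\lambda_{i,j}\mathbf p^i\mathbf q^j)=\max\{ri+sj:\lambda_{i,j}\neq0\}$ on nonzero elements of $A_1(K)$ and $\mathsf v_{r,s}(zw^{-1})=\mathsf v_{r,s}(z)-\mathsf v_{r,s}(w)$; $\widehat D_{r,s}$ is the completion of $D_1(K)$ with respect to $\mathsf v_{r,s}$. It is realized as the closure of $D_1(K)$ in $\widetilde D_{r,s}$ under the embedding $\mathbf q\mapsto T^s$, $\mathbf p\mapsto\alpha T^r$ (if $s\ne0$), or in $\check D_{r,s}$ under the embedding $\mathbf p\mapsto T^r$, $\mathbf q\mapsto T^s\beta$ (if $r\neq 0$). *)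

(* Defs.v *)
From HB Require Import structures.
From mathcomp Require Import all_boot all_order all_algebra.
From mathcomp Require Import generic_quotient fraction.
From mathcomp Require Import boolp classical_sets functions fsbigop.

Set Implicit Arguments.
Unset Strict Implicit.
Unset Printing Implicit Defensive.

Import Order.TTheory GRing.Theory Num.Theory.
Local Open Scope classical_set_scope.
Local Open Scope quotient_scope.
Local Open Scope ring_scope.

(* An algebra is given here by its carrier [A], a subset of an ambient type
   closed under the multiplication [mul]: centers, centralizers and
   commutativity involve no other part of the algebra structure. *)
Section CCC.
Variables (T : Type) (A : set T) (mul : T -> T -> T).

Definition alg_commutative (B : set T) : Prop :=
  forall y z, B y -> B z -> mul y z = mul z y.

Definition alg_center : set T :=
  [set x | A x /\ forall y, A y -> mul x y = mul y x].

Definition alg_centralizer (x : T) : set T :=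
  [set y | A y /\ mul x y = mul y x].

Definition ccc : Prop :=
  ~ alg_commutative A /\
  forall x, A x -> ~ alg_center x -> alg_commutative (alg_centralizer x).

End CCC.

Notation ratfun K := {fraction {poly K}}.

Definition fderiv (K : fieldType) (x : ratfun K) : ratfun K :=
  let n := \n_(repr x) in
  let d := \d_(repr x) in
  tofrac (n^`() * d - n * d^`()) / tofrac (d ^+ 2).

(* The value of [fderiv] does not depend on the fraction chosen by [repr]. *)
Lemma fderiv_frac (K : fieldType) (n d : {poly K}) : d != 0 ->
  fderiv (tofrac n / tofrac d) =
  tofrac (n^`() * d - n * d^`()) / tofrac (d ^+ 2).
Proof.
move=> d0; rewrite /fderiv.
set x := tofrac n / tofrac d.
set N := \n_(repr x); set E := \d_(repr x).
have E0 : E != 0 by exact: denom_ratioP.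
have xE : x = tofrac N / tofrac E.
  apply: (mulIf (x := tofrac E)); first by rewrite tofrac_eq0.
  rewrite divfK ?tofrac_eq0 //.
  have xM (y : {ratio {poly K}}) : FracField.mul (\pi y) (tofrac \d_y) = tofrac \n_y.
    unlock FracField.tofrac; rewrite -FracField.pi_mul; apply/eqP.
    rewrite FracField.equivf_def /FracField.mulf.
    by rewrite !numden_Ratio ?mulr1 ?oner_neq0 ?mulf_neq0 ?denom_ratioP // mulrC.
  by have := xM (repr x); rewrite reprK.
have key : N * d = n * E.
  apply/eqP; rewrite -tofrac_eq !tofracM; apply/eqP.
  have := xE; rewrite /x => /(congr1 (fun y => y * (tofrac d * tofrac E))).
  rewrite mulrA divfK ?tofrac_eq0 // [tofrac d * _]mulrC mulrA.
  by rewrite divfK ?tofrac_eq0 // => ->.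
have key' : N^`() * d + N * d^`() = n^`() * E + n * E^`().
  by rewrite -!derivM key.
apply/eqP; rewrite eqr_div ?tofrac_eq0 ?expf_neq0 // -!tofracM tofrac_eq.
apply/eqP.
have -> : (N^`() * E - N * E^`()) * d ^+ 2 =
   (N^`() * d) * (d * E) - (N * d) * (d * E^`()).
  by rewrite mulrBl expr2; congr (_ - _); rewrite -!mulrA; congr (_ * _);
     rewrite mulrCA; congr (_ * _); rewrite mulrC.
have -> : N^`() * d = n^`() * E + n * E^`() - N * d^`().
  by rewrite -key' addrK.
rewrite key mulrBl mulrDl.
have -> : N * d^`() * (d * E) = n * d^`() * E ^+ 2.
  have -> : N * d^`() * (d * E) = (N * d) * (d^`() * E).
    by rewrite -!mulrA; congr (_ * _); rewrite mulrCA.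
  by rewrite key expr2 -!mulrA; congr (_ * _); rewrite mulrCA.
have -> : n * E^`() * (d * E) = n * E * (d * E^`()).
  by rewrite -!mulrA; congr (_ * _); rewrite mulrC -!mulrA mulrCA.
rewrite addrAC addrK mulrBl; congr (_ - _).
by rewrite expr2 -!mulrA; congr (_ * _); rewrite mulrCA.
Qed.

Definition gbinom (F : fieldType) (a : F) (k : nat) : F :=
  (\prod_(i < k) (a - i%:R)) / k`!%:R.

(* [comm_coef F nu s i k] is lambda_i^k and [comm_coef F nu r j k] is mu_j^k;
   both are rational numbers, computed in the coefficient field. *)
Definition comm_coef (F : fieldType) (nu t i : int) (k : nat) : F :=
  if k == 0%N then 1 else
  (nu%:~R / t%:~R) ^+ k *
  \sum_(1 <= l < k.+1)
     (-1) ^+ (k - l) * gbinom (i%:~R : F) l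
     * gbinom ((i - l%:Z - 1)%:~R : F) (k - l)
     * gbinom (l%:R / nu%:~R : F) k.

Section Series.
Variables (K : fieldType) (r s : int).

Let F := ratfun K.
Let nu := r + s.

(* [f i] is the coefficient of T^i, written on the left of T^i in
   [D~_{r,s}] and on the right of T^i in [Dv_{r,s}]. *)
Definition series := int -> F.

(* deg f < N, with deg 0 = -oo *)
Definition deg_lt (f : series) (N : int) : Prop := forall i, N <= i -> f i = 0.

Definition laurent : set series := [set f | exists N, deg_lt f N].

Definition mono (i : int) (a : F) : series := fun j => if j == i then a else 0.

(* The sums below have finite support when [f] and [g] are in [laurent] and
   0 < nu; the index is the triple (i, j, k) = (t.1.1, t.1.2, t.2). *)
Definition tilde_mul (f g : series) : series := fun n =>
  \sum_(t \in [set t : int * int * nat | t.1.1 + t.1.2 - t.2%:Z * nu = n])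
     comm_coef F nu s t.1.1 t.2 * f t.1.1 * iter t.2 (@fderiv K) (g t.1.2).

Definition check_mul (f g : series) : series := fun n =>
  \sum_(t \in [set t : int * int * nat | t.1.1 + t.1.2 - t.2%:Z * nu = n])
     comm_coef F nu r t.1.2 t.2 * iter t.2 (@fderiv K) (f t.1.1) * g t.1.2.

(* The image of the Weyl algebra, i.e. the K-subalgebra generated by the
   images of p and q. *)
Inductive A1_image (mul : series -> series -> series) (p q : series) :
  series -> Prop :=
| A1_const c : A1_image mul p q (mono 0 (tofrac c%:P))
| A1_p : A1_image mul p q p
| A1_q : A1_image mul p q q
| A1_add f g :
    A1_image mul p q f -> A1_image mul p q g -> A1_image mul p q (f + g)
| A1_mul f g :
    A1_image mul p q f -> A1_image mul p q g -> A1_image mul p q (mul f g).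

(* The image of D_1(K): the elements f = z w^{-1}. *)
Definition D1_image (mul : series -> series -> series) (p q : series) :
  set series :=
  [set f | laurent f /\
     exists z w, [/\ A1_image mul p q z, A1_image mul p q w, w <> 0 &
                     mul f w = z]].

Definition deg_closure (B : set series) : set series :=
  [set f | laurent f /\ forall N, exists2 g, B g & deg_lt (f - g) N].

Definition alpha : F := tofrac 'X.

Definition hat_in_tilde : set series :=
  deg_closure (D1_image tilde_mul (mono r alpha) (mono s 1)).

Definition hat_in_check : set series :=
  deg_closure (D1_image check_mul (mono r 1) (mono s alpha)).

End Series.

Definition division_ring (D : unitRingType) : Prop :=
  forall x : D, x != 0 -> x \is a GRing.unit.

(* The element sum_{i,j} lambda_{i,j} p^i q^j, with lambda_{i,j} = c`_i`_j. *)
Definition weyl_elt (K : fieldType) (D : unitAlgType K) (p q : D)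
  (c : {poly {poly K}}) : D :=
  \sum_(i < size c) \sum_(j < size c`_i) (c`_i`_j) *: (p ^+ i * q ^+ j).

(* [D] is the quotient division ring of the subalgebra generated by [p] and
   [q]. In characteristic 0 the algebra A_1(K) is simple, so the relation
   qp - pq = 1 identifies this subalgebra with A_1(K). *)
Definition is_D1 (K : fieldType) (D : unitAlgType K) (p q : D) : Prop :=
  [/\ division_ring D,
      q * p - p * q = 1 &
      forall x : D, exists c d,
        weyl_elt p q d != 0 /\ x = weyl_elt p q c / weyl_elt p q d].

(* The value at 0, conventionally -oo, is left unspecified in the three
   definitions below: [v] only matters on nonzero elements. *)
Definition is_vrs (K : fieldType) (r s : int) (D : unitAlgType K) (p q : D)
  (v : D -> int) : Prop :=
  (forall c : {poly {poly K}}, c != 0 ->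
     (exists i j : nat,
        c`_i`_j != 0 /\ v (weyl_elt p q c) = r * i%:Z + s * j%:Z) /\
     (forall i j : nat,
        c`_i`_j != 0 -> r * i%:Z + s * j%:Z <= v (weyl_elt p q c))) /\
  (forall c d : {poly {poly K}},
     weyl_elt p q c != 0 -> weyl_elt p q d != 0 ->
     v (weyl_elt p q c / weyl_elt p q d) =
     v (weyl_elt p q c) - v (weyl_elt p q d)).

Definition is_degree (D : unitRingType) (v : D -> int) : Prop :=
  (forall x y, x != 0 -> y != 0 -> v (x * y) = v x + v y) /\
  (forall x y, x != 0 -> y != 0 -> x + y != 0 ->
     v (x + y) <= Num.max (v x) (v y)).

Definition v_lt (D : unitRingType) (v : D -> int) (x : D) (N : int) : Prop :=
  x = 0 \/ v x < N.

(* [vh] makes [Dh], via [iota], the completion of ([D], [v]): Cauchy sequences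
   and limits are those of the metric e^(vh (x - y)). *)
Definition is_completion (K : fieldType) (D Dh : unitAlgType K)
  (v : D -> int) (iota : D -> Dh) (vh : Dh -> int) : Prop :=
  [/\ division_ring Dh,
      is_degree vh,
      forall x, x != 0 -> vh (iota x) = v x,
      forall (y : Dh) N, exists x, v_lt vh (y - iota x) N &
      forall u : nat -> Dh,
        (forall N, exists n0 : nat, forall m n : nat,
           (n0 <= m)%N -> (n0 <= n)%N -> v_lt vh (u m - u n) N) ->
        exists l, forall N, exists n0 : nat, forall n : nat,
           (n0 <= n)%N -> v_lt vh (u n - l) N].

(* Main.v *)
(** For [x] of degree [i] and [y] of degree [j] in the series ring, with leading
    coefficients [a] and [b], the commutator [x y - y x] has degree at most
    [i + j - nu], and its coefficient there is [(i a b' - j b a') / s].  So if [f]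
    commutes with [g] and has degree [i <> 0], then [b ^ i / a ^ j] is a constant.
    If [g] and [h] commute with [f] but not with each other, let
    [e = deg g + deg h - deg (g h - h g) >= nu].  Subtracting from
    [g ^ |i|] a constant multiple of [f ^ |j|] (or, when [i] and [j] have opposite
    signs, a constant from [g ^ |i|  f ^ |j|]) gives an element commuting with [f]
    whose degree has dropped, while the degree of its commutator with [h] is the
    expected one: [e] decreases strictly, which is absurd.  When [f] has
    degree 0 and nonconstant leading coefficient, its centralizer is concentrated
    in degree 0, so that commutators in it, being of negative degree, vanish.

    Subrings follow because noncentral elements are not constants; [check_mul r s]
    is the opposite of [tilde_mul s r]; and the abstract completion embeds
    into a series ring, through fractions and then limits. *)

From HB Require Import structures.
From mathcomp Require Import all_boot all_order all_algebra.
From mathcomp Require Import generic_quotient fraction ring zify.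
From mathcomp Require Import boolp classical_sets functions fsbigop.
Require Import Defs.

Set Implicit Arguments.
Unset Strict Implicit.
Unset Printing Implicit Defensive.

Import Order.TTheory GRing.Theory Num.Theory.
Local Open Scope quotient_scope.
Local Open Scope ring_scope.

(** * Generalized binomial coefficients *)

Section GeneralizedBinomial.
Variable F : fieldType.
Hypothesis charF0 : [pchar F] =i pred0.

Let nat_neq0 (n : nat) : (n%:R != 0 :> F) = (n != 0)%N.
Proof. by move: charF0 => /pcharf0P ->. Qed.

Lemma gbinom0 (x : F) : gbinom x 0 = 1.
Proof. by rewrite /gbinom big_ord0 fact0 divr1. Qed.

Lemma gbinom1 (x : F) : gbinom x 1 = x.
Proof. by rewrite /gbinom big_ord1 subr0 divr1. Qed.

Lemma gbinomS (x : F) n : n.+1%:R * gbinom x n.+1 = (x - n%:R) * gbinom x n.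
Proof.
rewrite /gbinom big_ord_recr /= factS natrM.
have := nat_neq0 n.+1; have := nat_neq0 n`!; rewrite -lt0n fact_gt0 /= => h1 h2.
by field; rewrite h1 -[1 + _](natrD F 1 n) h2.
Qed.

Lemma gbinom_nat (m n : nat) : gbinom (m%:R : F) n = 'C(m, n)%:R.
Proof.
elim: n => [|n IHn]; first by rewrite gbinom0 bin0.
apply: (@mulfI _ n.+1%:R); first by rewrite nat_neq0.
rewrite gbinomS IHn.
case: (leqP n m) => [lenm|ltmn].
  by rewrite -natrB // -!natrM mul_bin_left.
by rewrite bin_small // (@bin_small m n.+1) ?mulr0 // ltnW.
Qed.

Lemma gbinomN1 n : gbinom (-1 : F) n = (-1) ^+ n.
Proof.
elim: n => [|n IHn]; first by rewrite gbinom0 expr0.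
apply: (@mulfI _ n.+1%:R); first by rewrite nat_neq0.
by rewrite gbinomS IHn exprS -natr1; ring.
Qed.

(** Induction on n: after multiplication by n + 1, this factor is split as m + (n + 1 - m) inside
    the sum, and [gbinomS] absorbs each half into one of the two binomials. *)
Lemma gbinom_vandermonde (x y : F) n :
  \sum_(m < n.+1) gbinom x m * gbinom y (n - m) = gbinom (x + y) n.
Proof.
elim: n => [|n IHn]; first by rewrite big_ord1 !gbinom0 mulr1.
apply: (@mulfI _ n.+1%:R); first by rewrite nat_neq0.
rewrite gbinomS -IHn !mulr_sumr.
transitivity (\sum_(m < n.+2) m%:R * gbinom x m * gbinom y (n.+1 - m) +
   \sum_(m < n.+2) gbinom x m * ((n.+1 - m)%:R * gbinom y (n.+1 - m))).
  rewrite -big_split; apply: eq_bigr => -[m /=]; rewrite ltnS => lemn _.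
  have -> : (n.+1%:R : F) = m%:R + (n.+1 - m)%:R by rewrite -natrD subnKC.
  ring.
rewrite big_ord_recl mul0r mul0r add0r [X in _ + X]big_ord_recr /=.
rewrite subnn mul0r mulr0 addr0 -big_split; apply: eq_bigr => -[m /= ltmn] _.
rewrite /bump /= add1n subSS gbinomS subSn // gbinomS.
have -> : ((n - m)%:R : F) = n%:R - m%:R by rewrite natrB.
ring.
Qed.

(** Trinomial revision; it separates the summation index from [u] in [comm_coef_vandermonde]. *)
Lemma gbinom_mul_bin (x : F) k u : (u <= k)%N ->
  gbinom x k * 'C(k, u)%:R = gbinom x u * gbinom (x - u%:R) (k - u).
Proof.
move=> /subnK <-; move: (k - u)%N => {k} n; rewrite addnK.
elim: n => [|n IHn]; first by rewrite add0n binn gbinom0.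
apply: (@mulfI _ n.+1%:R); first by rewrite nat_neq0.
rewrite [RHS]mulrCA gbinomS [RHS]mulrCA -IHn mulrCA -natrM addSn.
have -> : (n.+1 * 'C((n + u).+1, u) = (n + u).+1 * 'C(n + u, u))%N.
  by rewrite mul_bin_down; congr (_ * _)%N; lia.
by rewrite natrM mulrA [_ * (n + u).+1%:R]mulrC gbinomS natrD; ring.
Qed.

Lemma poly_eq0_on_nat (P : {poly F}) k :
  (size P <= k.+1)%N -> (forall m, (m <= k)%N -> P.[m%:R] = 0) -> P = 0.
Proof.
move=> szP rootP; apply: contraTeq szP => P0; rewrite -ltnNge.
have := @max_poly_roots F P [seq m%:R | m <- iota 0 k.+1] P0.
rewrite size_map size_iota; apply.
  by apply/allP => _ /mapP[m + ->]; rewrite mem_iota => mk; apply/eqP/rootP.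
rewrite map_inj_in_uniq ?iota_uniq // => m n _ _.
wlog lemn : m n / (m <= n)%N.
  by move=> H; case: (leqP m n) => [/H//|/ltnW/H h /esym/h].
move=> /esym/eqP; rewrite -subr_eq0 -natrB // => /eqP/eqP.
by have := nat_neq0 (n - m); case: eqP => // _ /esym/negbFE; lia.
Qed.

Definition gbinom_poly (p : {poly F}) k : {poly F} :=
  (k`!%:R)^-1 *: \prod_(i < k) (p - i%:R%:P).

Lemma horner_gbinom_poly p k x : (gbinom_poly p k).[x] = gbinom p.[x] k.
Proof.
rewrite /gbinom_poly /gbinom hornerZ horner_prod mulrC.
by congr (_ * _); apply: eq_bigr => i _; rewrite hornerD hornerN hornerC.
Qed.

Lemma size_gbinom_poly (p : {poly F}) k :
  (size p <= 2)%N -> (size (gbinom_poly p k) <= k.+1)%N.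
Proof.
move=> szp; apply: leq_trans (size_scale_leq _ _) _.
elim: k => [|k IHk]; first by rewrite big_ord0 size_poly1.
rewrite big_ord_recr /=; apply: leq_trans (size_polyMleq _ _) _.
have : (size (p - k%:R%:P)%R <= 2)%N.
  rewrite (leq_trans (size_polyD _ _)) // geq_max szp size_polyN.
  by rewrite (leq_trans (size_polyC_leq1 _)).
by move: IHk; set u := size _; set w := size _; lia.
Qed.

(* Lagrange interpolation at 0, .., k of the polynomial
   [x |-> gbinom (x / nu) k], which vanishes at 0. *)
Lemma comm_coefE (nu t i : int) k :
  comm_coef F nu t i k =
  (nu%:~R / t%:~R) ^+ k * gbinom (i%:~R / nu%:~R) k.
Proof.
rewrite /comm_coef; case: eqP => [->|/eqP k0].
  by rewrite expr0 gbinom0 mulr1.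
congr (_ * _); pose P : {poly F} := \sum_(1 <= l < k.+1)
  ((-1) ^+ (k - l) * gbinom (l%:R / nu%:~R : F) k) *:
   (gbinom_poly 'X l * gbinom_poly ('X - (l%:R + 1)%:P) (k - l)) -
  gbinom_poly ((nu%:~R)^-1 *: 'X) k.
have EP x : P.[x] = \sum_(1 <= l < k.+1)
     (-1) ^+ (k - l) * gbinom x l * gbinom (x - l%:R - 1) (k - l)
     * gbinom (l%:R / nu%:~R : F) k - gbinom (x / nu%:~R) k.
  rewrite /P hornerD hornerN horner_sum horner_gbinom_poly hornerZ hornerX.
  rewrite [x / _]mulrC; congr (_ - _); apply: eq_bigr => l _.
  rewrite hornerZ hornerM !horner_gbinom_poly hornerD hornerN hornerX hornerC.
  by rewrite opprD addrA; ring.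
suff P0 : P = 0.
  apply/eqP; rewrite -subr_eq0 -[X in _ == X](horner0 (i%:~R : F)) -P0 EP.
  by apply/eqP; congr (_ - _); apply: eq_bigr => l _; rewrite !intrD !mulrNz.
apply: (@poly_eq0_on_nat _ k) => [|m lemk].
  rewrite (leq_trans (size_polyD _ _)) // geq_max size_polyN; apply/andP; split.
    rewrite big_nat; apply: (big_ind (fun q : {poly F} => size q <= k.+1)%N).
    - by rewrite size_poly0.
    - by move=> p q hp hq; rewrite (leq_trans (size_polyD _ _)) // geq_max hp.
    move=> l /andP[_]; rewrite ltnS => lek.
    apply: leq_trans (size_scale_leq _ _) _.
    apply: leq_trans (size_polyMleq _ _) _.
    have := @size_gbinom_poly 'X l; rewrite size_polyX => /(_ isT).
    have := @size_gbinom_poly ('X - (l%:R + 1)%:P) (k - l).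
    rewrite size_XsubC => /(_ isT).
    by set u := size _; set w := size _; lia.
  apply: size_gbinom_poly; apply: leq_trans (size_scale_leq _ _) _.
  by rewrite size_polyX.
rewrite EP; apply/eqP; rewrite subr_eq0; apply/eqP.
have [->|m_gt0] := posnP m.
  rewrite big_nat big1 => [|l /andP[l_gt0 _]].
    by rewrite mul0r (gbinom_nat 0) bin0n (negPf k0).
  by rewrite (gbinom_nat 0) bin0n eqn0Ngt l_gt0 mulr0 !mul0r.
(* At the node m only l = m survives: for l > m the first binomial vanishes, for l < m the second
   one, whose upper argument m - l - 1 is a natural number below k - l. At l = m the factor
   [gbinom (-1) (k - m)] cancels the sign. *)
rewrite (bigD1_seq m) ?iota_uniq ?mem_index_iota ?m_gt0 ?ltnS ?lemk //=.
rewrite big1 ?addr0 => [|l neq].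
  rewrite subrr sub0r gbinomN1 gbinom_nat binn mulr1 -expr2 sqrr_sign.
  by rewrite mul1r.
case: (ltngtP l m) neq => // [ltlm _|ltml _]; last first.
  by rewrite gbinom_nat bin_small // mulr0 !mul0r.
have -> : (m%:R - l%:R - 1 : F) = (m - l - 1)%:R by rewrite !natrB //; lia.
by rewrite gbinom_nat bin_small ?mulr0 ?mul0r //; lia.
Qed.

Lemma intr_neq0 (m : int) : m != 0 -> m%:~R != 0 :> F.
Proof.
by case: m => k; rewrite ?NegzE ?mulrNz ?oppr_eq0 -pmulrn nat_neq0.
Qed.

Lemma comm_coef0 (nu t i : int) : comm_coef F nu t i 0 = 1.
Proof. by []. Qed.

Lemma comm_coef1 (nu t i : int) : nu != 0 -> t != 0 ->
  comm_coef F nu t i 1 = i%:~R / t%:~R.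
Proof.
move=> /intr_neq0 nu0 /intr_neq0 t0; rewrite comm_coefE expr1 gbinom1.
by field; rewrite nu0 t0.
Qed.

(** The numerical identity behind associativity. The left side comes from f (g h), where u of the k
    derivatives fall on g by Leibniz, the right side from (f g) h. With the closed form [comm_coefE]
    it becomes trinomial revision followed by Vandermonde. *)
Lemma comm_coef_vandermonde (nu t i j : int) u w : nu != 0 -> (u <= w)%N ->
  let L := comm_coef F nu t in
  \sum_(k < w.+1 | (u <= k)%N) L i k * L j (w - k)%N * 'C(k, u)%:R =
  L i u * L (i + j - u%:Z * nu) (w - u)%N.
Proof.
move=> /intr_neq0 nu0 leuw /=.
under eq_bigr do rewrite !comm_coefE.
rewrite !comm_coefE; set rho := _ / _.
set x := i%:~R / _; set y := j%:~R / _.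
have -> : (i + j - u%:Z * nu)%:~R / nu%:~R = (x - u%:R) + y.
  by rewrite /x /y !intrD mulrNz intrM; field.
rewrite mulrACA -exprD subnKC //.
rewrite -gbinom_vandermonde !mulr_sumr.
rewrite -(big_mkord (fun k => u <= k)%N (fun k => rho ^+ k * gbinom x k *
  (rho ^+ (w - k) * gbinom y (w - k)) * 'C(k, u)%:R)).
rewrite (@big_cat_nat _ _ _ u) //= ?(leq_trans leuw) //.
rewrite big_nat_cond big1 ?add0r; last by move=> k; lia.
rewrite -{1}[u]add0n big_addn subSn // -[(w - u).+1](subn0) big_mkord.
rewrite subn0; apply: eq_big => [m|m _]; first by rewrite leq_addl.
rewrite mulrACA -exprD subnKC; last by have := ltn_ord m; lia.
rewrite -mulrA; congr (_ * _).
rewrite mulrAC gbinom_mul_bin ?leq_addl // addnK -mulrA.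
by congr (_ * (_ * gbinom y _)); lia.
Qed.

End GeneralizedBinomial.

(** * The derivation of the field of rational functions *)

Section RationalDerivation.
Variable K : fieldType.
Local Notation F := (ratfun K).
Local Notation "x %:F" := (tofrac x).

Lemma ratfun_frac (x : F) : exists n d : {poly K}, d != 0 /\ x = n%:F / d%:F.
Proof.
exists \n_(repr x), \d_(repr x); have d0 : \d_(repr x) != 0 by exact: denom_ratioP.
split=> //; apply: (mulIf (x := (\d_(repr x))%:F)); first by rewrite tofrac_eq0.
rewrite divfK ?tofrac_eq0 //.
have xM (y : {ratio {poly K}}) : FracField.mul (\pi y) (\d_y)%:F = (\n_y)%:F.
  unlock FracField.tofrac; rewrite -FracField.pi_mul; apply/eqP.
  rewrite FracField.equivf_def /FracField.mulf.
  by rewrite !numden_Ratio ?mulr1 ?oner_neq0 ?mulf_neq0 ?denom_ratioP // mulrC.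
by have := xM (repr x); rewrite reprK.
Qed.

Lemma ratfun_coprime_frac (x : F) :
  exists n d : {poly K}, [/\ d != 0, coprimep n d & x = n%:F / d%:F].
Proof.
have [n [d [d0 ->]]] := ratfun_frac x.
have g0 : gcdp n d != 0 by rewrite gcdp_eq0 negb_and d0 orbT.
have dE := divpK (dvdp_gcdr n d).
have d'0 : d %/ gcdp n d != 0 by apply: contra_neq d0 => z; rewrite -dE z mul0r.
exists (n %/ gcdp n d), (d %/ gcdp n d); split=> //.
  by rewrite coprimep_div_gcd // d0 orbT.
apply/eqP; rewrite eqr_div ?tofrac_eq0 // -!tofracM tofrac_eq; apply/eqP.
have := divpK (dvdp_gcdl n d); move: dE; set g := gcdp n d.
by move: (d %/ g) (n %/ g) => d' n' <- <-; ring.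
Qed.

Lemma fderivD : {morph @fderiv K : x y / x + y}.
Proof.
move=> x y; have [a [b [b0 ->]]] := ratfun_frac x.
have [c [d [d0 ->]]] := ratfun_frac y.
rewrite addf_div ?tofrac_eq0 // -!tofracM -tofracD !fderiv_frac ?mulf_neq0 //.
rewrite addf_div ?tofrac_eq0 ?expf_neq0 // -!tofracM -tofracD.
apply/eqP; rewrite eqr_div ?tofrac_eq0 ?mulf_neq0 ?expf_neq0 ?mulf_neq0 //.
rewrite -!tofracM tofrac_eq; apply/eqP.
by rewrite !derivE; ring.
Qed.

Lemma fderivM (x y : F) : fderiv (x * y) = fderiv x * y + x * fderiv y.
Proof.
have [a [b [b0 ->]]] := ratfun_frac x.
have [c [d [d0 ->]]] := ratfun_frac y.
rewrite mulf_div -!tofracM !fderiv_frac ?mulf_neq0 // !mulf_div -!tofracM.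
rewrite addf_div ?tofrac_eq0 ?mulf_neq0 ?expf_neq0 // -!tofracM -tofracD.
apply/eqP; rewrite eqr_div ?tofrac_eq0 ?mulf_neq0 ?expf_neq0 ?mulf_neq0 //.
rewrite -!tofracM tofrac_eq; apply/eqP.
by rewrite !derivE; ring.
Qed.

Lemma fderiv_tofrac (p : {poly K}) : fderiv p%:F = (p^`())%:F :> F.
Proof.
have := fderiv_frac p (oner_neq0 {poly K}); rewrite tofrac1 divr1 => ->.
by rewrite derivC mulr1 mulr0 subr0 expr1n tofrac1 divr1.
Qed.

Lemma fderivC (c : K) : fderiv (c%:P)%:F = 0 :> F.
Proof. by rewrite fderiv_tofrac derivC tofrac0. Qed.

Lemma fderiv0 : fderiv (0 : F) = 0.
Proof. by rewrite -[0 in LHS]tofrac0 fderivC. Qed.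

Lemma fderiv1 : fderiv (1 : F) = 0.
Proof. by rewrite -tofrac1 -(fderivC 1). Qed.

Lemma fderiv_alpha : fderiv (alpha K) = 1.
Proof. by rewrite fderiv_tofrac derivX tofrac1. Qed.

Lemma fderivCM (c : K) (x : F) : fderiv ((c%:P)%:F * x) = (c%:P)%:F * fderiv x.
Proof. by rewrite fderivM fderivC mul0r add0r. Qed.

Lemma fderiv_sum (I : Type) (s : seq I) (P : pred I) (E : I -> F) :
  fderiv (\sum_(i <- s | P i) E i) = \sum_(i <- s | P i) fderiv (E i).
Proof. exact: (big_morph _ fderivD fderiv0). Qed.

Lemma charK_ratfun : [pchar K] =i pred0 -> [pchar F] =i pred0.
Proof.
move=> /pcharf0P cK; apply/pcharf0P => n.
by rewrite -(tofrac1 {poly K}) -tofracMn tofrac_eq0 -polyCMn polyC_eq0 cK.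
Qed.

Lemma deriv_eq0 (p : {poly K}) : [pchar K] =i pred0 ->
  p^`() = 0 -> exists c, p = c%:P.
Proof.
move=> /pcharf0P cK p'0; exists p`_0; apply/polyP => -[|i]; rewrite coefC //=.
have /(congr1 (fun q : {poly K} => q`_i)) := p'0.
by rewrite coef_deriv coef0 -mulr_natr => /eqP; rewrite mulf_eq0 cK orbF => /eqP.
Qed.

(** In lowest terms, n' d = n d' forces d to divide d', so d' = 0 by degree; then n' = 0 as well,
    and both are constants in characteristic 0. *)
Lemma fderiv_eq0 (x : F) : [pchar K] =i pred0 ->
  fderiv x = 0 -> exists c : K, x = (c%:P)%:F.
Proof.
move=> cK; have [n [d [d0 cop ->]]] := ratfun_coprime_frac x.
rewrite fderiv_frac // => /eqP; rewrite mulf_eq0 invr_eq0 !tofrac_eq0.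
rewrite (negPf (expf_neq0 _ d0)) orbF subr_eq0 => /eqP E.
have dvd : d %| d^`().
  by rewrite -(@Gauss_dvdpr _ d^`() n) 1?coprimep_sym // -E dvdp_mull.
have d'0 : d^`() = 0.
  apply/eqP; apply: contraTT (lt_size_deriv d0) => nz.
  by rewrite -leqNgt dvdp_leq.
have n'0 : n^`() = 0.
  by move/eqP: E; rewrite d'0 mulr0 mulf_eq0 (negPf d0) orbF => /eqP.
have [c dE] := deriv_eq0 cK d'0; have [b ->] := deriv_eq0 cK n'0.
have c0 : c != 0 by rewrite -polyC_eq0 -dE.
exists (b / c); apply: (mulIf (x := d%:F)); first by rewrite tofrac_eq0.
by rewrite divfK ?tofrac_eq0 // -tofracM dE -polyCM divfK.
Qed.

Definition fderivn k : F -> F := iter k (@fderiv K).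

Lemma fderivnD k : {morph fderivn k : x y / x + y}.
Proof. by elim: k => // k IHk x y; rewrite /fderivn !iterS [iter k _ _]IHk fderivD. Qed.

Lemma fderivn0 k : fderivn k 0 = 0.
Proof. by elim: k => // k IHk; rewrite /fderivn iterS [iter k _ _]IHk fderiv0. Qed.

Lemma fderivn_sum k (I : Type) (s : seq I) (P : pred I) (E : I -> F) :
  fderivn k (\sum_(i <- s | P i) E i) = \sum_(i <- s | P i) fderivn k (E i).
Proof. exact: (big_morph _ (fderivnD k) (fderivn0 k)). Qed.

Lemma fderivnCM k (c : K) (x : F) : fderivn k ((c%:P)%:F * x) = (c%:P)%:F * fderivn k x.
Proof. by elim: k => // k IHk; rewrite /fderivn !iterS [iter k _ _]IHk fderivCM. Qed.

Lemma fderivnC k (c : K) : (0 < k)%N -> fderivn k (c%:P)%:F = 0.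
Proof. by case: k => // k _; rewrite /fderivn iterSr fderivC [iter _ _ _]fderivn0. Qed.

Lemma fderivn_add k l x : fderivn k (fderivn l x) = fderivn (k + l) x.
Proof. by rewrite /fderivn -iterD. Qed.

Lemma fderivn_leibniz k (x y : F) :
  fderivn k (x * y) = \sum_(u < k.+1) 'C(k, u)%:R * fderivn u x * fderivn (k - u) y.
Proof.
elim: k => [|k IHk]; first by rewrite big_ord1 bin0 mul1r.
rewrite {1}/fderivn iterS [iter k _ _]IHk fderiv_sum.
transitivity (\sum_(u < k.+1) 'C(k, u)%:R * fderivn u.+1 x * fderivn (k - u) y +
  \sum_(u < k.+1) 'C(k, u)%:R * fderivn u x * fderivn (k.+1 - u) y).
  rewrite -big_split; apply: eq_bigr => -[u /=]; rewrite ltnS => leuk _.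
  have -> : 'C(k, u)%:R = ('C(k, u)%:R%:P)%:F :> F.
    by rewrite -[in LHS](tofrac1 {poly K}) -tofracMn -polyC1 -polyCMn.
  by rewrite -mulrA fderivCM fderivM mulrDr subSn // /fderivn !iterS !mulrA.
rewrite [RHS]big_ord_recl bin0 [X in _ + X = _]big_ord_recl bin0 !subn0.
rewrite addrCA; congr (_ + _).
transitivity (\sum_(u < k.+1) 'C(k, u)%:R * fderivn u.+1 x * fderivn (k - u) y +
  \sum_(u < k.+1) 'C(k, u.+1)%:R * fderivn u.+1 x * fderivn (k - u) y).
  congr (_ + _); rewrite [RHS]big_ord_recr /= bin_small // !mul0r addr0.
  by apply: eq_bigr => u _; rewrite subSS.
rewrite -big_split; apply: eq_bigr => u _; rewrite !lift0 subSS binS natrD.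
by rewrite /= !mulrDl addrC.
Qed.

End RationalDerivation.

(** * The product of series *)

(** A substitution e = b + d that keeps the range [N], so that all the nested sums below can run
    over one common box. *)
Lemma sum_ord_shift (V : nmodType) (N d : nat) (E : nat -> V) :
  (forall e, (e < d)%N -> E e = 0) -> (forall e, (N <= e)%N -> E e = 0) ->
  \sum_(e < N) E e = \sum_(b < N) E (b + d)%N.
Proof.
move=> Elt Ege; rewrite -!(big_mkord xpredT) /=.
have H M : (N <= M)%N -> \sum_(0 <= e < M) E e = \sum_(0 <= e < N) E e.
  move=> leNM; rewrite (big_cat_nat (leq0n N) leNM) //=.
  rewrite [X in _ + X]big_nat_cond [X in _ + X]big1 ?addr0 //.
  by move=> i /andP[/andP[/Ege]].
rewrite -(H (N + d)%N) ?leq_addr // (big_cat_nat (leq0n d) (leq_addl N d)) //=.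
rewrite [X in X + _]big_nat_cond [X in X + _]big1 ?add0r;
  last by move=> i /andP[/andP[_ /Elt]].
by rewrite -{1}[d]add0n big_addn addnK big_mkord.
Qed.

(** Regrouping by the total number w = k + m of derivatives. *)
Lemma sum_triangle (V : nmodType) (N : nat) (E : nat -> nat -> V) :
  (forall k m, (N <= k + m)%N -> E k m = 0) ->
  \sum_(k < N) \sum_(m < N) E k m = \sum_(w < N) \sum_(k < w.+1) E k (w - k)%N.
Proof.
move=> E0; transitivity (\sum_(k < N) \sum_(w < N)
   if (k <= w)%N then E k (w - k)%N else 0).
  apply: eq_bigr => k _.
  rewrite (@sum_ord_shift _ N k (fun w => if (k <= w)%N then E k (w - k)%N else 0)).
  - by apply: eq_bigr => m _; rewrite leq_addl addnK.
  - by move=> e; rewrite ltnNge => /negbTE ->.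
  by move=> e leNe; case: ifP => // leke; rewrite E0 // subnKC.
rewrite exchange_big /=; apply: eq_bigr => w _; rewrite -big_mkcond /=.
rewrite -(big_mkord (fun k => k <= w)%N (fun k => E k (w - k)%N)).
rewrite -(big_mkord xpredT (fun k => E k (w - k)%N)).
rewrite (@big_cat_nat _ _ _ w.+1) //= [X in _ + X]big_nat_cond [X in _ + X]big1 ?addr0.
  by rewrite big_nat_cond [RHS]big_nat_cond; apply: eq_bigl => k; rewrite /= ltnS; lia.
by move=> k; lia.
Qed.

Lemma exchange_big22 (V : nmodType) (I J I' J' : finType) (E : I -> J -> I' -> J' -> V) :
  \sum_i \sum_j \sum_k \sum_l E i j k l = \sum_k \sum_l \sum_i \sum_j E i j k l.
Proof.
rewrite pair_bigA; under eq_bigr do rewrite pair_bigA.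
rewrite exchange_big [RHS]pair_bigA /=.
by apply: eq_bigr => p _; rewrite pair_bigA.
Qed.

Lemma rmorph_gbinom (F F' : fieldType) (phi : {rmorphism F -> F'}) x k :
  phi (gbinom x k) = gbinom (phi x) k.
Proof.
rewrite /gbinom fmorph_div rmorph_prod rmorph_nat; congr (_ / _).
by apply: eq_bigr => i _; rewrite rmorphB rmorph_nat.
Qed.

(** Applied to the inclusion of [K], this shows that the structure coefficients are constants, hence
    pass through the derivation. *)
Lemma rmorph_comm_coef (F F' : fieldType) (phi : {rmorphism F -> F'}) nu t i k :
  phi (comm_coef F nu t i k) = comm_coef F' nu t i k.
Proof.
rewrite /comm_coef; case: ifP => _; first by rewrite rmorph1.
rewrite rmorphM rmorphXn fmorph_div !rmorph_int rmorph_sum; congr (_ * _).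
apply: eq_bigr => l _; rewrite 3!rmorphM rmorphXn rmorphN1 !rmorph_gbinom.
by rewrite fmorph_div !rmorph_int rmorph_nat.
Qed.

(** * Degree bounds for series *)

Section SeriesDegree.
Variable K : fieldType.
Local Notation F := (ratfun K).

Definition deg_le (f : series K) (A : int) := forall i, A < i -> f i = 0.

Lemma deg_le_laurent (f : series K) A : deg_le f A -> laurent f.
Proof. by move=> fA; exists (A + 1) => i le; apply: fA; lia. Qed.

Lemma laurent_deg_le (f : series K) : laurent f -> exists A, deg_le f A.
Proof. by move=> [N fN]; exists N => i lt; apply: fN; lia. Qed.

Lemma deg_le_mono (f : series K) A B : A <= B -> deg_le f A -> deg_le f B.
Proof. by move=> AB fA i lt; apply: fA; lia. Qed.

Lemma mono_deg_le i (a : F) : deg_le (mono i a) i.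
Proof. by move=> j; rewrite /mono; case: eqP => // ->; rewrite ltxx. Qed.

Lemma mono_laurent i (a : F) : laurent (mono i a).
Proof. exact: deg_le_laurent (mono_deg_le a). Qed.

End SeriesDegree.

(** * Coefficients of a product, top terms of a commutator, and distributivity *)

Section TildeMul.
Variables (K : fieldType) (r s : int).
Hypothesis charK0 : [pchar K] =i pred0.
Hypothesis nu_gt0 : 0 < r + s.

Local Notation F := (ratfun K).
Local Notation nu := (r + s).
Local Notation L := (comm_coef F nu s).
Local Notation "x %:F" := (tofrac x).

(** Put i = A - a and j = B - b. The index condition reads a + b + k nu = A + B - n, so a nonzero
    term has a, b >= 0, and nu >= 1 then bounds both a and k by A + B - n. The index j is recovered
    from a, k and n. *)
Lemma tilde_mulE (f g : series K) A B (N : nat) n : deg_le f A -> deg_le g B ->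
  A + B - n < N%:Z ->
  tilde_mul r s f g n = \sum_(k < N) \sum_(a < N)
    L (A - a%:Z) k * f (A - a%:Z) * fderivn k (g (n + k%:Z * nu - A + a%:Z)).
Proof.
move=> fA gB ltN; rewrite /tilde_mul.
pose h (k a : nat) : int * int * nat := (A - a%:Z, n + k%:Z * nu - A + a%:Z, k).
rewrite (fsbigE [seq h k a | k <- iota 0 N, a <- iota 0 N]).
- transitivity (\sum_(t <- [seq h k a | k <- iota 0 N, a <- iota 0 N])
     L t.1.1 t.2 * f t.1.1 * fderivn t.2 (g t.1.2)).
    rewrite [LHS]big_seq_cond [RHS]big_seq; apply: eq_bigl => t.
    case: (boolP (t \in _)) => //= /allpairsP[[k a] [_ _ ->]] /=.
    by apply/mem_set => /=; ring.
  have iotaE (E : nat -> F) : \sum_(i <- iota 0 N) E i = \sum_(i < N) E i.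
    by rewrite -(big_mkord xpredT) /index_iota subn0.
  by rewrite big_allpairs_dep iotaE; apply: eq_bigr => k _; rewrite iotaE.
- apply: allpairs_uniq; rewrite ?iota_uniq //.
  by move=> [k a] [k' a'] _ _ [/= + _ ->]; move=> e; congr (_, _); lia.
- by move=> _ /allpairsP[[k a] [_ _ ->]] /=; ring.
move=> [[i j] k] /= ijk; case: (ltP A i) => [/fA -> _|leiA]; first by rewrite mulr0 mul0r.
case: (ltP B j) => [/gB -> _|lejB]; first by rewrite [iter _ _ _]fderivn0 mulr0.
move=> /negP[]; apply/allpairsP; exists (k, `|A - i|%N) => /=.
have kk : k%:Z <= k%:Z * nu by rewrite ler_peMr //; lia.
split; rewrite ?mem_iota ?add0n /=; [lia | lia |].
by rewrite /h gez0_abs; [congr (_, _, _); lia | lia].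
Qed.

Lemma fderivn_comm_coefM k i m x : fderivn k (L i m * x) = L i m * fderivn k x.
Proof.
have -> : L i m = ((comm_coef K nu s i m)%:P)%:F.
  by rewrite -(rmorph_comm_coef (@FracField.tofrac {poly K} \o @polyC K)).
exact: fderivnCM.
Qed.

Lemma tilde_mul_deg (f g : series K) A B : deg_le f A -> deg_le g B ->
  deg_le (tilde_mul r s f g) (A + B).
Proof.
move=> fA gB n ltn; rewrite (tilde_mulE (N := 0) fA gB); last by lia.
by rewrite big_ord0.
Qed.

Lemma tilde_mul_lead (f g : series K) A B : deg_le f A -> deg_le g B ->
  tilde_mul r s f g (A + B) = f A * g B.
Proof.
move=> fA gB; rewrite (tilde_mulE (N := 1) fA gB); last by lia.
rewrite !big_ord1 comm_coef0 mul1r !subr0 mul0r !addr0 /fderivn /=.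
by congr (_ * g _); ring.
Qed.

(** In degrees at least A + B - nu, terms with k >= 2 vanish, and k = 1 contributes only through the
    top coefficient of f. *)
Lemma tilde_mul_near_top (f g : series K) A B n (N : nat) : deg_le f A -> deg_le g B ->
  A + B - nu <= n -> A + B - n < N%:Z -> (0 < N)%N ->
  tilde_mul r s f g n = \sum_(a < N) f (A - a%:Z) * g (n - A + a%:Z) +
    L A 1 * f A * fderiv (g (n + nu - A)).
Proof.
move=> fA gB len ltN N_gt0.
have ltN2 : A + B - n < (N.+2)%:Z by lia.
rewrite (tilde_mulE fA gB ltN2).
rewrite big_ord_recl big_ord_recl; congr (_ + _).
  rewrite !big_ord_recr /= !gB ?mulr0 ?addr0 /fderivn /=; [|lia|lia].
  by apply: eq_bigr => a _; rewrite comm_coef0 mul1r mul0r addr0.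
rewrite [X in _ + X]big1 ?addr0 => [|k _]; last first.
  apply: big1 => a _; rewrite gB ?fderivn0 ?mulr0 // !lift0.
  have : 2 * nu <= k.+2%:Z * nu by rewrite ler_pM2r //; lia.
  by lia.
rewrite big_ord_recl big1 ?addr0 => [|a _].
  by rewrite !lift0 /= /fderivn /= mul1r.
by rewrite gB ?fderivn0 ?mulr0 // !lift0 /=; lia.
Qed.

(** The terms with k = 0 form a commutative convolution and cancel, leaving the two terms with k =
    1. *)
Lemma tilde_mul_comm (f g : series K) A B n :
  deg_le f A -> deg_le g B -> A + B - nu <= n ->
  tilde_mul r s f g n - tilde_mul r s g f n =
  L A 1 * f A * fderiv (g (n + nu - A)) - L B 1 * g B * fderiv (f (n + nu - B)).
Proof.
move=> fA gB len; pose N := (absz (A + B - n)%R).+1.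
case: (ltP (A + B) n) => [ltn|leAB].
  rewrite (tilde_mul_deg fA gB) // (tilde_mul_deg gB fA); last by lia.
  rewrite (gB (n + nu - A)) ?(fA (n + nu - B)) ?fderiv0 ?mulr0 //; lia.
have hN : A + B - n < N%:Z by lia.
have hN' : B + A - n < N%:Z by lia.
have len' : B + A - nu <= n by lia.
rewrite (tilde_mul_near_top fA gB len hN) // (tilde_mul_near_top gB fA len' hN') //.
suff -> : \sum_(a < N) f (A - a%:Z) * g (n - A + a%:Z) =
          \sum_(a < N) g (B - a%:Z) * f (n - B + a%:Z) by ring.
(* Here N is exactly A + B - n + 1, so reversing the range exchanges the roles of the two
   factors. *)
rewrite (reindex_inj rev_ord_inj) /=; apply: eq_bigr => a _.
have := ltn_ord a; rewrite mulrC => lta.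
by congr (g _ * f _); rewrite /N in lta *; lia.
Qed.

Lemma tilde_mulDl (f g h : series K) : laurent f -> laurent g -> laurent h ->
  tilde_mul r s (f + g) h = tilde_mul r s f h + tilde_mul r s g h.
Proof.
move=> /laurent_deg_le[A fA] /laurent_deg_le[B gB] /laurent_deg_le[C hC].
pose M := Num.max A B; have [AM BM] : A <= M /\ B <= M by rewrite /M; lia.
have fM := deg_le_mono AM fA; have gM := deg_le_mono BM gB.
have fgM : deg_le (f + g) M by move=> i lt; rewrite -[LHS]/(f i + g i) fM ?gM ?addr0.
apply/funext => n; pose N := (absz (M + C - n)%R).+1.
have ltN : M + C - n < N%:Z by lia.
rewrite -[RHS]/(tilde_mul r s f h n + tilde_mul r s g h n).
rewrite (tilde_mulE fM hC ltN) (tilde_mulE gM hC ltN) (tilde_mulE fgM hC ltN).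
rewrite -big_split; apply: eq_bigr => k _; rewrite -big_split; apply: eq_bigr => a _ /=.
by rewrite mulrDr mulrDl.
Qed.

Lemma tilde_mulDr (f g h : series K) : laurent f -> laurent g -> laurent h ->
  tilde_mul r s f (g + h) = tilde_mul r s f g + tilde_mul r s f h.
Proof.
move=> /laurent_deg_le[C fC] /laurent_deg_le[A gA] /laurent_deg_le[B hB].
pose M := Num.max A B; have [AM BM] : A <= M /\ B <= M by rewrite /M; lia.
have gM := deg_le_mono AM gA; have hM := deg_le_mono BM hB.
have ghM : deg_le (g + h) M by move=> i lt; rewrite -[LHS]/(g i + h i) gM ?hM ?addr0.
apply/funext => n; pose N := (absz (C + M - n)%R).+1.
have ltN : C + M - n < N%:Z by lia.
rewrite -[RHS]/(tilde_mul r s f g n + tilde_mul r s f h n).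
rewrite (tilde_mulE fC gM ltN) (tilde_mulE fC hM ltN) (tilde_mulE fC ghM ltN).
rewrite -big_split; apply: eq_bigr => k _; rewrite -big_split; apply: eq_bigr => a _ /=.
by rewrite fderivnD mulrDr.
Qed.

Lemma tilde_mul_laurent (f g : series K) :
  laurent f -> laurent g -> laurent (tilde_mul r s f g).
Proof.
move=> /laurent_deg_le[A fA] /laurent_deg_le[B gB].
exact: deg_le_laurent (tilde_mul_deg fA gB).
Qed.

Lemma tilde_mulCl (c : K) (f : series K) : laurent f ->
  tilde_mul r s (mono 0 (c%:P)%:F) f = fun n => (c%:P)%:F * f n.
Proof.
move=> /laurent_deg_le[A fA]; apply/funext => n.
pose N := (absz (0 + A - n)%R).
rewrite (tilde_mulE (N := N.+1) (mono_deg_le _) fA); last by lia.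
rewrite big_ord_recl [X in _ + X]big1 ?addr0 => [|k _]; last first.
  apply: big1 => a _; rewrite /mono; case: eqP => [e|]; last by rewrite mulr0 mul0r.
  have -> : (0 - a%:Z) = 0 by lia.
  (* At i = 0 the coefficient is a multiple of [gbinom 0 k], which is 0 for k > 0. *)
  rewrite (comm_coefE (charK_ratfun charK0)) mul0r (gbinom_nat (charK_ratfun charK0) 0).
  by rewrite bin0n /= mulr0 !mul0r.
rewrite big_ord_recl big1 ?addr0 => [|a _]; last first.
  by rewrite /mono; case: eqP => [|_]; [rewrite lift0; lia | rewrite mulr0 mul0r].
rewrite comm_coef0 /mono /= mul1r /fderivn /=; congr (_ * f _); lia.
Qed.

Lemma tilde_mulCr (c : K) (f : series K) : laurent f ->
  tilde_mul r s f (mono 0 (c%:P)%:F) = fun n => (c%:P)%:F * f n.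
Proof.
move=> /laurent_deg_le[A fA]; apply/funext => n.
pose N := (absz (A + 0 - n)%R).+1.
rewrite (tilde_mulE (N := N) fA (mono_deg_le _)); last by lia.
rewrite big_ord_recl [X in _ + X]big1 ?addr0 => [|k _]; last first.
  apply: big1 => a _; rewrite /mono; case: eqP => _; last by rewrite fderivn0 mulr0.
  by rewrite fderivnC ?mulr0 // lift0.
have [leAn|ltnA] := leP n A; last first.
  rewrite fA // mulr0 big1 // => a _; rewrite /mono; case: eqP => [/=|_]; first by lia.
  by rewrite fderivn0 mulr0.
have lt : (absz (A - n)%R < N)%N by lia.
rewrite (bigD1 (Ordinal lt)) //= [X in _ + X]big1 ?addr0 => [|a neq]; last first.
  rewrite /mono; case: eqP => [e|_]; last by rewrite mulr0.
  by move: neq e; rewrite -val_eqE /=; lia.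
rewrite comm_coef0 mul1r /mono /fderivn /= ifT; last by lia.
by rewrite mulrC; congr (_ * f _); lia.
Qed.

End TildeMul.

(** * Associativity of the product *)

Section TildeAssoc.
Variables (K : fieldType) (r s : int).
Hypothesis charK0 : [pchar K] =i pred0.
Hypothesis nu_gt0 : 0 < r + s.

Local Notation F := (ratfun K).
Local Notation nu := (r + s).
Local Notation L := (comm_coef F nu s).
Local Notation "x %:F" := (tofrac x).

Variables (f g h : series K) (A B C : int) (n : int) (N : nat).
Hypotheses (fA : deg_le f A) (gB : deg_le g B) (hC : deg_le h C).
Hypothesis ltN : A + B + C - n < N%:Z.

(* Coefficient of [f i * g j ^(u) * h l ^(w - u)] with [i = A - a], [j = B - b],
   the exponent [l] being determined by [i + j + l - w nu = n]. *)
Definition assoc_term (a b w u : nat) : F :=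
  f (A - a%:Z) * (L (A - a%:Z) u * L (A - a%:Z + (B - b%:Z) - u%:Z * nu) (w - u)%N
   * fderivn u (g (B - b%:Z)) *
   fderivn (w - u)%N (h (n + w%:Z * nu - A - B + a%:Z + b%:Z))).

Let h_vanish (a b k m : nat) : (N <= k + m)%N ->
  h (n + (k + m)%:Z * nu - A - B + a%:Z + b%:Z) = 0.
Proof.
move=> leN; apply: hC.
have : (k + m)%:Z <= (k + m)%:Z * nu by rewrite ler_peMr //; lia.
by lia.
Qed.

Lemma tilde_mulA_left : tilde_mul r s (tilde_mul r s f g) h n =
  \sum_(a < N) \sum_(b < N) \sum_(w < N) \sum_(u < w.+1) assoc_term a b w u.
Proof.
rewrite (tilde_mulE nu_gt0 (tilde_mul_deg nu_gt0 fA gB) hC ltN).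
pose T (m e k a : nat) : F := L (A + B - e%:Z) m *
   (L (A - a%:Z) k * f (A - a%:Z) * fderivn k (g (A + B - e%:Z + k%:Z * nu - A + a%:Z))) *
   fderivn m (h (n + m%:Z * nu - (A + B) + e%:Z)).
transitivity (\sum_(m < N) \sum_(e < N) \sum_(k < N) \sum_(a < N) T m e k a).
  apply: eq_bigr => m _; apply: eq_bigr => e _.
  rewrite (tilde_mulE (N := N) nu_gt0 fA gB); last by have := ltn_ord e; lia.
  rewrite mulr_sumr mulr_suml; apply: eq_bigr => k _.
  by rewrite mulr_sumr mulr_suml.
rewrite exchange_big22 exchange_big; apply: eq_bigr => a _.
pose U (b k m : nat) : F := f (A - a%:Z) *
  (L (A - a%:Z) k * L (A - a%:Z + (B - b%:Z) - k%:Z * nu) m *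
   fderivn k (g (B - b%:Z)) *
   fderivn m (h (n + (k + m)%:Z * nu - A - B + a%:Z + b%:Z))).
transitivity (\sum_(k < N) \sum_(m < N) \sum_(b < N) U b k m).
  apply: eq_bigr => k _; apply: eq_bigr => m _.
  (* The substitution e = b + k nu + a turns the index of the coefficient of g into B - b; below
     that shift g vanishes, and beyond the range h does. *)
  rewrite (@sum_ord_shift _ N (k * `|nu| + a)%N (fun e => T m e k a)).
  - apply: eq_bigr => b _; rewrite /T /U.
    have -> : A + B - (b + (k * `|nu| + a))%N%:Z = A - a%:Z + (B - b%:Z) - k%:Z * nu.
      by rewrite !PoszD PoszM gez0_abs ?ltW //; ring.
    have -> : A - a%:Z + (B - b%:Z) - k%:Z * nu + k%:Z * nu - A + a%:Z = B - b%:Z by ring.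
    have -> : n + m%:Z * nu - (A + B) + (b + (k * `|nu| + a))%N%:Z =
              n + (k + m)%:Z * nu - A - B + a%:Z + b%:Z.
      by rewrite !PoszD PoszM gez0_abs ?ltW //; ring.
    by ring.
  - move=> e lte; rewrite /T gB ?fderivn0 ?mulr0 ?mul0r //.
    have : (e%:Z < (k * `|nu| + a)%N%:Z) by [].
    by rewrite !PoszD PoszM gez0_abs ?ltW //; lia.
  move=> e leNe; rewrite /T hC ?fderivn0 ?mulr0 //.
  have : 0 <= m%:Z * nu by rewrite mulr_ge0 // ltW.
  by lia.
under eq_bigr do rewrite exchange_big.
rewrite exchange_big; apply: eq_bigr => b _.
rewrite (@sum_triangle _ N (U b)) => [|k m leN]; last first.
  by rewrite /U h_vanish // fderivn0 !mulr0.
apply: eq_bigr => w _; apply: eq_bigr => u _; rewrite /U /assoc_term subnKC //.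
by have := ltn_ord u; lia.
Qed.

Lemma tilde_mulA_right : tilde_mul r s f (tilde_mul r s g h) n =
  \sum_(a < N) \sum_(b < N) \sum_(w < N) \sum_(u < w.+1) assoc_term a b w u.
Proof.
rewrite (@tilde_mulE _ _ _ nu_gt0 _ _ A (B + C) N) //; last 2 first.
- exact: tilde_mul_deg.
- by lia.
pose U (b a k m : nat) : F := f (A - a%:Z) * (L (A - a%:Z) k * L (B - b%:Z) m *
  \sum_(u < k.+1) 'C(k, u)%:R * fderivn u (g (B - b%:Z)) *
   fderivn (k + m - u)%N (h (n + (k + m)%:Z * nu - A - B + a%:Z + b%:Z))).
transitivity (\sum_(k < N) \sum_(a < N) \sum_(m < N) \sum_(b < N) U b a k m).
  apply: eq_bigr => k _; apply: eq_bigr => a _.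
  have kn : 0 <= k%:Z * nu by rewrite mulr_ge0 // ltW.
  rewrite (tilde_mulE (N := N) nu_gt0 gB hC); last by lia.
  rewrite fderivn_sum mulr_sumr; apply: eq_bigr => m _.
  rewrite fderivn_sum mulr_sumr; apply: eq_bigr => b _.
  rewrite -[L (B - b%:Z) m * _ * _]mulrA fderivn_comm_coefM fderivn_leibniz /U.
  have -> : \sum_(u < k.+1) 'C(k, u)%:R * fderivn u (g (B - (b : nat)%:Z)) *
     fderivn (k - u) (fderivn m (h (n + k%:Z * nu - A + a%:Z + m%:Z * nu - B + b%:Z))) =
    \sum_(u < k.+1) 'C(k, u)%:R * fderivn u (g (B - b%:Z)) *
   fderivn (k + m - u)%N (h (n + (k + m)%:Z * nu - A - B + a%:Z + b%:Z)).
    apply: eq_bigr => u _; rewrite fderivn_add.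
    have -> : (k - u + m = k + m - u)%N by have := ltn_ord u; lia.
    by congr (_ * fderivn _ (h _)); rewrite PoszD; ring.
  by ring.
rewrite exchange_big; apply: eq_bigr => a _.
under eq_bigr do rewrite exchange_big.
rewrite exchange_big; apply: eq_bigr => b _ /=.
rewrite (@sum_triangle _ N (U b a)) => [|k m leN]; last first.
  rewrite /U h_vanish // big1 ?mulr0 // => u _.
  by rewrite fderivn0 mulr0.
(* For fixed a, b, w the sum over k is exchanged with the Leibniz sum over u. The product of
   derivatives then depends on u and w alone, and the sum over k of the numerical factors is given
   by [comm_coef_vandermonde]. *)
apply: eq_bigr => w _; rewrite /U -mulr_sumr -[RHS]mulr_sumr; congr (_ * _).
transitivity (\sum_(k < w.+1) \sum_(u < w.+1 | (u <= k)%N)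
  L (A - a%:Z) k * L (B - b%:Z) (w - k)%N * 'C(k, u)%:R * (fderivn u (g (B - b%:Z)) *
   fderivn (w - u)%N (h (n + w%:Z * nu - A - B + a%:Z + b%:Z)))).
  apply: eq_bigr => k _; have lek := ltn_ord k.
  rewrite subnKC // mulr_sumr (big_ord_widen _ (fun u : nat => L (A - a%:Z) k *
    L (B - b%:Z) (w - k)%N * ('C(k, u)%:R * fderivn u (g (B - b%:Z)) *
    fderivn (w - u)%N (h (n + w%:Z * nu - A - B + a%:Z + b%:Z)))) lek).
  by apply: eq_big => [u|u _]; [rewrite ltnS | ring].
rewrite (exchange_big_dep xpredT) //=; apply: eq_bigr => u _.
rewrite -mulr_suml (comm_coef_vandermonde (charK_ratfun charK0)) ?lt0r_neq0 //.
  by rewrite !mulrA.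
by rewrite -ltnS.
Qed.

Lemma tilde_mulA_coef :
  tilde_mul r s f (tilde_mul r s g h) n = tilde_mul r s (tilde_mul r s f g) h n.
Proof. by rewrite tilde_mulA_left tilde_mulA_right. Qed.

End TildeAssoc.

Lemma tilde_mulA (K : fieldType) (r s : int) (f g h : series K) :
  [pchar K] =i pred0 -> 0 < r + s -> laurent f -> laurent g -> laurent h ->
  tilde_mul r s f (tilde_mul r s g h) = tilde_mul r s (tilde_mul r s f g) h.
Proof.
move=> charK0 nu_gt0 lf lg lh; have [A fA] := laurent_deg_le lf.
have [B gB] := laurent_deg_le lg; have [C hC] := laurent_deg_le lh.
apply/funext => n; pose N := (absz (A + B + C - n)%R).+1.
have ltN : A + B + C - n < N%:Z by lia.
exact: (tilde_mulA_coef charK0 nu_gt0 fA gB hC ltN).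
Qed.

(** * The algebra of series *)

(* The hypotheses are parameters of the type so that canonical structure
   inference can recover the proofs of the algebra axioms from it. *)
Definition tilde_ring (K : fieldType) (r s : int)
    (charK0 : [pchar K] =i pred0) (nu_gt0 : 0 < r + s) : Type :=
  {f : series K | laurent f}.

Section TildeRing.
Variables (K : fieldType) (r s : int).
Hypothesis charK0 : [pchar K] =i pred0.
Hypothesis nu_gt0 : 0 < r + s.

Local Notation F := (ratfun K).
Local Notation nu := (r + s).
Local Notation "x %:F" := (tofrac x).
Local Notation T := (tilde_ring charK0 nu_gt0).

Definition tser (x : T) : int -> F := sval x.
Coercion tser : tilde_ring >-> Funclass.

Lemma tserP (x : T) : laurent (tser x). Proof. exact: svalP. Qed.

Lemma tser_inj : injective tser.
Proof. by move=> [f lf] [g lg] /= e; apply: eq_exist. Qed.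

HB.instance Definition _ := gen_eqMixin T.
HB.instance Definition _ := gen_choiceMixin T.

Lemma laurentD (f g : series K) : laurent f -> laurent g -> laurent (f + g).
Proof.
move=> [M fM] [N gN]; exists (Num.max M N) => i le.
by rewrite -[LHS]/(f i + g i) fM ?gN ?addr0 //; lia.
Qed.

Lemma laurentN (f : series K) : laurent f -> laurent (- f).
Proof. by move=> [M fM]; exists M => i le; rewrite -[LHS]/(- f i) fM ?oppr0. Qed.

Lemma laurentZ (c : F) (f : series K) : laurent f -> laurent (fun n => c * f n).
Proof. by move=> [M fM]; exists M => i le; rewrite fM ?mulr0. Qed.

Let laurent0 : laurent (0 : series K). Proof. by exists 0. Qed.

Definition tzero : T := exist _ 0 laurent0.
Definition topp (x : T) : T := exist _ _ (laurentN (tserP x)).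
Definition tadd (x y : T) : T := exist _ _ (laurentD (tserP x) (tserP y)).
Definition tmono i (a : F) : T := exist _ _ (mono_laurent i a).
Definition tmul (x y : T) : T :=
  exist _ _ (tilde_mul_laurent nu_gt0 (tserP x) (tserP y)).
Definition tscale (c : K) (x : T) : T := exist _ _ (laurentZ (c%:P)%:F (tserP x)).

Let taddA : associative tadd.
Proof. by move=> x y z; apply/tser_inj/addrA. Qed.
Let taddC : commutative tadd.
Proof. by move=> x y; apply/tser_inj/addrC. Qed.
Let tadd0 : left_id tzero tadd.
Proof. by move=> x; apply/tser_inj/add0r. Qed.
Let taddN : left_inverse tzero topp tadd.
Proof. by move=> x; apply/tser_inj/addNr. Qed.

HB.instance Definition _ := GRing.isZmodule.Build T taddA taddC tadd0 taddN.

Let tmulA : associative tmul.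
Proof. by move=> x y z; apply/tser_inj/tilde_mulA => //; exact: tserP. Qed.
Let tmul1 : left_id (tmono 0 1) tmul.
Proof.
move=> x; apply/tser_inj/funext => n.
have /(congr1 (@^~ n)) := tilde_mulCl charK0 nu_gt0 1 (tserP x).
by rewrite polyC1 tofrac1 mul1r.
Qed.
Let tmulr1 : right_id (tmono 0 1) tmul.
Proof.
move=> x; apply/tser_inj/funext => n.
have /(congr1 (@^~ n)) := tilde_mulCr nu_gt0 1 (tserP x).
by rewrite polyC1 tofrac1 mul1r.
Qed.
Let tmulDl : left_distributive tmul +%R.
Proof. by move=> x y z; apply/tser_inj/tilde_mulDl => //; exact: tserP. Qed.
Let tmulDr : right_distributive tmul +%R.
Proof. by move=> x y z; apply/tser_inj/tilde_mulDr => //; exact: tserP. Qed.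
Let tone_neq0 : tmono 0 1 != 0.
Proof.
apply/eqP => /(congr1 (fun x : T => x 0)); rewrite /tser /= /mono eqxx.
by move/eqP; rewrite oner_eq0.
Qed.

HB.instance Definition _ := GRing.Zmodule_isNzRing.Build T
  tmulA tmul1 tmulr1 tmulDl tmulDr tone_neq0.

Let tscaleA a b x : tscale a (tscale b x) = tscale (a * b) x.
Proof.
by apply/tser_inj/funext => n; rewrite /tser /= polyCM tofracM mulrA.
Qed.
Let tscale1 : left_id 1 tscale.
Proof. by move=> x; apply/tser_inj/funext => n; rewrite /tser /= tofrac1 mul1r. Qed.
Let tscaleDr : right_distributive tscale +%R.
Proof. by move=> c x y; apply/tser_inj/funext => n; exact: mulrDr. Qed.
Let tscaleDl x : {morph tscale^~ x : a b / a + b}.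
Proof.
move=> a b; apply/tser_inj/funext => n.
by rewrite /tser /= polyCD tofracD; exact: mulrDl.
Qed.

HB.instance Definition _ := GRing.Zmodule_isLmodule.Build K T
  tscaleA tscale1 tscaleDr tscaleDl.

Let tscale_monol c (x : T) : c *: x = tmono 0 (c%:P)%:F * x.
Proof. by apply/tser_inj/esym/tilde_mulCl => //; exact: tserP. Qed.
Let tscale_monor c (x : T) : c *: x = x * tmono 0 (c%:P)%:F.
Proof. by apply/tser_inj/esym/tilde_mulCr => //; exact: tserP. Qed.

Let tscaleAl c (x y : T) : c *: (x * y) = (c *: x) * y.
Proof. by rewrite !tscale_monol mulrA. Qed.
HB.instance Definition _ := GRing.Lmodule_isLalgebra.Build K T tscaleAl.

Let tscaleAr c (x y : T) : c *: (x * y) = x * (c *: y).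
Proof. by rewrite !tscale_monor mulrA. Qed.
HB.instance Definition _ := GRing.Lalgebra_isAlgebra.Build K T tscaleAr.

Lemma tserM (x y : T) : tser (x * y) = tilde_mul r s x y. Proof. by []. Qed.
Lemma tserD (x y : T) n : tser (x + y) n = x n + y n. Proof. by []. Qed.
Lemma tserN (x : T) n : tser (- x) n = - x n. Proof. by []. Qed.
Lemma tserB (x y : T) n : tser (x - y) n = x n - y n. Proof. by []. Qed.
Lemma tserZ c (x : T) n : tser (c *: x) n = (c%:P)%:F * x n. Proof. by []. Qed.
Lemma tser0 n : tser 0 n = 0. Proof. by []. Qed.

Lemma tser_alg c : tser (c%:A) = mono 0 (c%:P)%:F.
Proof.
apply/funext => n; rewrite tserZ -[tser 1 n]/(mono 0 1 n) /mono.
by case: eqP => _; rewrite ?mulr1 ?mulr0.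
Qed.

Lemma tser_sum (I : Type) (l : seq I) (P : pred I) (E : I -> T) n :
  tser (\sum_(i <- l | P i) E i) n = \sum_(i <- l | P i) E i n.
Proof. by elim/big_rec2: _ => // i a b _ <-; rewrite tserD. Qed.

End TildeRing.

(** * Degrees and centralizers *)

Section TildeDegree.
Variables (K : fieldType) (r s : int).
Hypothesis charK0 : [pchar K] =i pred0.
Hypothesis nu_gt0 : 0 < r + s.

Local Notation F := (ratfun K).
Local Notation nu := (r + s).
Local Notation "x %:F" := (tofrac x).
Local Notation T := (tilde_ring charK0 nu_gt0).

Implicit Types (x y z f g h : T) (m n : int).

Local Notation dle x n := (deg_le (tser x) n).

Definition has_deg x n := dle x n /\ x n != 0.

Lemma deg_le_ex x : exists n, dle x n.
Proof. exact: laurent_deg_le (tserP x). Qed.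

Lemma deg_le_all x : (forall n, dle x n) -> x = 0.
Proof. by move=> h; apply/tser_inj/funext => i; apply: (h (i - 1)); lia. Qed.

Lemma deg_leD x y n : dle x n -> dle y n -> dle (x + y) n.
Proof. by move=> hx hy i lt; rewrite tserD hx ?hy ?addr0. Qed.

Lemma deg_leN x n : dle x n -> dle (- x) n.
Proof. by move=> hx i lt; rewrite tserN hx ?oppr0. Qed.

Lemma deg_leB x y n : dle x n -> dle y n -> dle (x - y) n.
Proof. by move=> hx hy; apply: deg_leD => //; apply: deg_leN. Qed.

Lemma deg_leM x y m n : dle x m -> dle y n -> dle (x * y) (m + n).
Proof. by rewrite tserM; exact: tilde_mul_deg. Qed.

Lemma lead_coefM x y m n : dle x m -> dle y n -> tser (x * y) (m + n) = x m * y n.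
Proof. by rewrite tserM; exact: tilde_mul_lead. Qed.

Lemma deg_leZ c x n : dle x n -> dle (c *: x) n.
Proof. by move=> hx i lt; rewrite tserZ hx ?mulr0. Qed.

Lemma deg_le_alg c : dle (c%:A : T) 0.
Proof. by rewrite tser_alg; exact: mono_deg_le. Qed.

Lemma deg_le_pred x n : dle x n -> x n = 0 -> dle x (n - 1).
Proof. by move=> hx xn i lt; have [-> //|ne] := eqVneq i n; apply: hx; lia. Qed.

Lemma deg_le_predB x y n : dle x n -> dle y n -> x n = y n ->
  dle (x - y) (n - 1).
Proof.
by move=> hx hy e; apply: deg_le_pred; [apply: deg_leB | rewrite tserB e subrr].
Qed.

Lemma has_deg_ex x : x != 0 -> exists n, has_deg x n.
Proof.
move=> x0; have [A xA] := deg_le_ex x.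
have ex : exists k : nat, x (A - k%:Z) != 0.
  apply: contrapT => /forallNP h; move/eqP: x0; apply.
  apply/tser_inj/funext => i; have [lt|le] := ltP A i; first exact: xA.
  have := h (absz (A - i)); have -> : A - (absz (A - i)%R)%:Z = i by lia.
  by move/negP/negPn/eqP.
have [k nz kmin] := ex_minnP ex; exists (A - k%:Z); split=> // i lt.
have [ltA|le] := ltP A i; first exact: xA.
apply/eqP/negPn/negP => nzi; have := kmin (absz (A - i)).
have -> : A - (absz (A - i)%R)%:Z = i by lia.
by move/(_ nzi); lia.
Qed.

Lemma has_deg_neq0 x n : has_deg x n -> x != 0.
Proof. by case=> _; apply: contra_neq => ->; rewrite tser0. Qed.

Lemma has_deg_le x n m : has_deg x n -> dle x m -> n <= m.
Proof. by move=> [_ nz] xm; rewrite leNgt; apply: contra nz => /xm ->. Qed.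

Lemma has_deg_uniq x n m : has_deg x n -> has_deg x m -> n = m.
Proof.
move=> xn xm; apply/eqP; rewrite eq_le (has_deg_le xn) ?(has_deg_le xm) //.
  by case: xn.
by case: xm.
Qed.

Lemma has_degM x y m n : has_deg x m -> has_deg y n -> has_deg (x * y) (m + n).
Proof.
move=> [xm nx] [yn ny]; split; first exact: deg_leM.
by rewrite (lead_coefM xm yn); exact: (mulf_neq0 nx ny).
Qed.

Lemma tilde_mulf_neq0 x y : x != 0 -> y != 0 -> x * y != 0.
Proof.
move=> /has_deg_ex[m hx] /has_deg_ex[n hy].
exact: has_deg_neq0 (has_degM hx hy).
Qed.

Lemma tilde_mulIf x y z : z != 0 -> x * z = y * z -> x = y.
Proof.
move=> z0 e; apply/eqP; rewrite -subr_eq0; apply: contraT => nz.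
by have := tilde_mulf_neq0 nz z0; rewrite mulrBl e subrr eqxx.
Qed.

Lemma has_deg1 : has_deg (1 : T) 0.
Proof.
rewrite -(scale1r 1); split; first exact: deg_le_alg.
by rewrite tser_alg /mono eqxx tofrac1 oner_eq0.
Qed.

Lemma has_degX x n k : has_deg x n -> has_deg (x ^+ k) (n * k%:Z).
Proof.
move=> xn; elim: k => [|k IHk]; first by rewrite mulr0; exact: has_deg1.
by rewrite exprS intS mulrDr mulr1; exact: has_degM.
Qed.

Lemma deg_leX x n k : dle x n -> dle (x ^+ k) (n * k%:Z).
Proof.
move=> xn; elim: k => [|k IHk]; first by rewrite mulr0; case: has_deg1.
by rewrite exprS intS mulrDr mulr1; exact: deg_leM.
Qed.

Lemma lead_coefX x n k : dle x n -> tser (x ^+ k) (n * k%:Z) = x n ^+ k.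
Proof.
move=> xn; elim: k => [|k IHk].
  by rewrite mulr0 expr0 [tser 1]/(mono 0 1) /mono eqxx.
by rewrite exprS intS mulrDr mulr1 (lead_coefM xn (deg_leX xn)) IHk -exprS.
Qed.

(** Each coefficient of the sequence is eventually constant, and the limit collects these final
    values. *)
Lemma tilde_complete (u : nat -> T) (A : int) :
  (forall k, dle (u k.+1 - u k) (A - k%:Z)) ->
  exists l : T, forall k, dle (l - u k) (A - k%:Z).
Proof.
move=> du.
have dum k d : dle (u (k + d)%N - u k) (A - k%:Z).
  elim: d => [|d IHd]; first by rewrite addn0 subrr => i _; rewrite tser0.
  rewrite addnS -(subrK (u (k + d)%N) (u (k + d).+1)) -addrA.
  by apply: deg_leD => //; apply: deg_le_mono (du _); lia.
(* The coefficient of degree i no longer changes from stage A - i + 1 on; above degree A it is final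
   at stage 0. *)
pose idx (i : int) : nat := if i <= A then (absz (A - i)).+1 else 0.
have agree i k : A - k%:Z < i -> u (idx i) i = u k i.
  move=> lt; apply/esym/eqP; rewrite -subr_eq0 -tserB; apply/eqP.
  have le : (idx i <= k)%N by rewrite /idx; case: ifP; lia.
  rewrite -(subnKC le); apply: dum; rewrite /idx; case: ifP; lia.
have ll : laurent (fun i => u (idx i) i).
  have [B uB] := deg_le_ex (u 0); apply: (@deg_le_laurent _ _ (Num.max A B)).
  by move=> i lt; rewrite (agree i 0) ?uB //; lia.
exists (exist _ _ ll) => k i lt; rewrite tserB -(agree i k lt) /tser /=.
exact: subrr.
Qed.

(** Long division: each stage subtracts the monomial that cancels the top coefficient of the error f
    y - z, and the quotients converge by [tilde_complete]. *)
Lemma tilde_divl y z : y != 0 -> exists f, f * y = z.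
Proof.
move=> /has_deg_ex[n [yn y0]]; have [M zM] := deg_le_ex z.
pose corr k f : T :=
  tmono charK0 nu_gt0 (M - k%:Z - n) (tser (f * y - z) (M - k%:Z) / y n).
pose fix u k := if k is k'.+1 then u k' - corr k' (u k') else 0.
have corr_deg k f : dle (corr k f) (M - k%:Z - n) by exact: mono_deg_le.
have uy k : dle (u k * y - z) (M - k%:Z).
  elim: k => [|k IHk]; first by rewrite mul0r sub0r subr0; exact: deg_leN.
  have -> : u k.+1 * y - z = (u k * y - z) - corr k (u k) * y.
    by rewrite mulrBl addrAC.
  have eM : M - k%:Z = (M - k%:Z - n) + n by ring.
  have -> : M - k.+1%:Z = M - k%:Z - 1 by lia.
  apply: deg_le_predB => //; first by rewrite eM; exact: deg_leM.
  rewrite {2}eM (lead_coefM (corr_deg k (u k)) yn).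
  by rewrite [tser (corr k _)]/(mono _ _) /mono eqxx divfK.
have [|l hl] := @tilde_complete u (M - n).
  move=> k; have -> : u k.+1 - u k = - corr k (u k) by rewrite addrAC subrr sub0r.
  by apply: deg_leN; apply: deg_le_mono (corr_deg _ _); lia.
exists l; apply/eqP; rewrite -subr_eq0; apply/eqP/deg_le_all => N.
pose k := absz (M - N).
have -> : l * y - z = (l - u k) * y + (u k * y - z) by rewrite mulrBl addrA subrK.
apply: deg_leD; last by apply: deg_le_mono (uy k); lia.
by apply: deg_le_mono (deg_leM (hl k) yn); lia.
Qed.

(** * Leading terms of commutators and the descent on centralizers *)

Hypothesis s_neq0 : s != 0.

Lemma commutator_deg x y m n : dle x m -> dle y n ->
  dle (x * y - y * x) (m + n - nu).
Proof.
move=> xm yn i lt; rewrite tserB !tserM (tilde_mul_comm nu_gt0 xm yn) //; last by lia.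
by rewrite (yn (i + nu - m)) ?(xm (i + nu - n)) ?fderiv0 ?mulr0 ?subr0 //; lia.
Qed.

Lemma commutator_lead x y m n : dle x m -> dle y n ->
  tser (x * y - y * x) (m + n - nu) =
  (m%:~R * x m * fderiv (y n) - n%:~R * y n * fderiv (x m)) / s%:~R.
Proof.
move=> xm yn; rewrite tserB !tserM (tilde_mul_comm nu_gt0 xm yn) //.
rewrite !(comm_coef1 (charK_ratfun charK0) _ (lt0r_neq0 nu_gt0) s_neq0).
have -> : m + n - nu + nu - m = n by ring.
have -> : m + n - nu + nu - n = m by ring.
by move: (s%:~R^-1 : F) => t; ring.
Qed.

Lemma commute_lead x y m n : x * y = y * x -> dle x m -> dle y n ->
  m%:~R * x m * fderiv (y n) = n%:~R * y n * fderiv (x m).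
Proof.
move=> xy xm yn; apply/eqP; rewrite -subr_eq0.
have := commutator_lead xm yn; rewrite xy subrr tser0 => /esym/eqP.
by rewrite mulf_eq0 invr_eq0 (negPf (intr_neq0 (charK_ratfun charK0) s_neq0)) orbF.
Qed.

Lemma commute_deg0 x y i : x * y = y * x -> has_deg x i -> i != 0 ->
  dle y 0 -> exists c, dle (y - c%:A) (-1).
Proof.
move=> xy [xi nx] i0 y0; have := commute_lead xy xi y0.
rewrite !mul0r => /eqP; rewrite mulf_eq0.
rewrite (negPf (mulf_neq0 (intr_neq0 (charK_ratfun charK0) i0) nx)) /= => /eqP.
move=> y'0; have [c e] := fderiv_eq0 charK0 y'0; exists c.
suff : dle (y - c%:A) (0 - 1) by []; apply: deg_le_predB => //; first exact: deg_le_alg.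
by rewrite e tser_alg /mono eqxx.
Qed.

Lemma commute_same_deg x y i : x * y = y * x -> has_deg x i -> i != 0 ->
  dle y i -> exists c, dle (y - c *: x) (i - 1).
Proof.
move=> xy [xi nx] i0 yi; have := commute_lead xy xi yi.
(* In equal degrees the commutation relation reduces to x_i^2 q' = 0 for the ratio q of the top
   coefficients, so q is a constant. *)
pose q := y i / x i; have yq : y i = q * x i by rewrite divfK.
rewrite -!mulrA => /(mulfI (intr_neq0 (charK_ratfun charK0) i0)).
rewrite yq fderivM => e; have : x i * (fderiv q * x i) = 0.
  have -> : x i * (fderiv q * x i) =
    x i * (fderiv q * x i + q * fderiv (x i)) - q * x i * fderiv (x i) by ring.
  by rewrite e mulrA subrr.
move/eqP; rewrite mulf_eq0 (negPf nx) /= mulf_eq0 (negPf nx) orbF.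
move=> /eqP q'0; have [c {}e] := fderiv_eq0 charK0 q'0; exists c.
have yc : y i = tser (c *: x) i by rewrite tserZ yq e.
exact: (deg_le_predB yi (@deg_leZ c _ _ xi) yc).
Qed.

Lemma commutatorM x y z : (x * y) * z - z * (x * y) =
  x * (y * z - z * y) + (x * z - z * x) * y.
Proof. by rewrite mulrBr mulrBl !mulrA addrA subrK. Qed.

Lemma commutatorX_deg g h j l d k : has_deg g j -> dle h l ->
  has_deg (g * h - h * g) d ->
  has_deg (g ^+ k.+1 * h - h * g ^+ k.+1) (j * k%:Z + d).
Proof.
move=> gj hl ghd; have [gj' ng] := gj; have [gh' ngh] := ghd.
(* The bracket with h is a derivation, and top coefficients commute in the field: that of the
   bracket of g^(k+1) is (k + 1) g_j^k times that of the bracket of g, nonzero in characteristic 0.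
   The induction has to carry this value. *)
suff [h1 h2] : dle (g ^+ k.+1 * h - h * g ^+ k.+1) (j * k%:Z + d) /\
   tser (g ^+ k.+1 * h - h * g ^+ k.+1) (j * k%:Z + d) =
   k.+1%:R * (g j ^+ k * tser (g * h - h * g) d).
  have k0 : (k.+1%:R : F) != 0.
    by have /pcharf0P -> := charK_ratfun charK0.
  split; first exact: h1.
  by rewrite h2 (mulf_neq0 k0 (mulf_neq0 (expf_neq0 k ng) ngh)).
elim: k => [|k [IH1 IH2]]; first by rewrite mulr0 add0r expr1 expr0 !mul1r.
have Xj := deg_leX (k := k.+1) gj'.
have e1 : j * k.+1%:Z + d = j + (j * k%:Z + d) by rewrite intS; ring.
have e2 : j * k.+1%:Z + d = d + j * k.+1%:Z by rewrite addrC.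
rewrite exprS commutatorM; split.
  by apply: deg_leD; [rewrite e1; exact: deg_leM | rewrite e2; exact: deg_leM].
rewrite tserD {1}e1 (lead_coefM gj' IH1) IH2 e2 (lead_coefM gh' Xj) (lead_coefX k.+1 gj').
rewrite exprS -[k.+2%:R]natr1.
by ring.
Qed.

Lemma commuteX x y k : x * y = y * x -> x * y ^+ k = y ^+ k * x.
Proof. by move=> xy; exact: (@commrX _ x y k xy). Qed.

Lemma centralizer_no_bracket f i : has_deg f i -> i != 0 ->
  forall (e : nat) g h j l d, f * g = g * f -> f * h = h * f ->
  has_deg g j -> has_deg h l -> has_deg (g * h - h * g) d ->
  j + l - d = e%:Z -> False.
Proof.
move=> fi i0; elim/ltn_ind => e IH g h j l d fg fh gj hl ghd ee.
have [hl' _] := hl.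
(* [D] is the degree expected of the new element before cancellation. The degree of [g1] falls below
   [D], while the bracket with h moves by exactly D - j, so the new defect is smaller than e. By
   [commutator_deg] it is still at least nu, hence a natural number. *)
suff [g1 [D [fg1 g1D g1h]]] : exists g1 D, [/\ f * g1 = g1 * f,
    dle g1 (D - 1) & has_deg (g1 * h - h * g1) (D - j + d)].
  have g1n : g1 != 0.
    by apply/eqP => g10; have := has_deg_neq0 g1h; rewrite g10 mul0r mulr0 subrr eqxx.
  have [j1 g1j] := has_deg_ex g1n; have [g1j' _] := g1j.
  have j1D := has_deg_le g1j g1D.
  have := has_deg_le g1h (commutator_deg g1j' hl') => le.
  have lt : (absz (j1 + l - (D - j + d))%R < e)%N by lia.
  by apply: (IH _ lt g1 h j1 l (D - j + d) fg1 fh g1j hl g1h); lia.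
have [ai aiE] : exists k : nat, absz i = k.+1 by exists (absz i).-1; lia.
have gX := commutatorX_deg ai gj hl' ghd.
have fgX : f * g ^+ ai.+1 = g ^+ ai.+1 * f by exact: commuteX.
have fX k : f * f ^+ k = f ^+ k * f by rewrite -exprS exprSr.
have fXh k : h * f ^+ k = f ^+ k * h by exact: commuteX.
have [ijpos|ijneg] := ltP 0 (i * j).
  (* Same signs: g^|i| and f^|j| have the same degree, and a constant multiple of the second cancels
     the top term of the first without affecting the bracket with h. *)
  have dE : j * ai.+1%:Z = i * (absz j)%:Z by rewrite -aiE; nia.
  have gXd := has_degX ai.+1 gj; rewrite dE in gXd.
  have fXd := has_degX (absz j) fi; have [gXd' _] := gXd.
  have fXgX : f ^+ absz j * g ^+ ai.+1 = g ^+ ai.+1 * f ^+ absz j.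
    by apply/esym; apply: commuteX.
  have [|c hc] := commute_same_deg fXgX fXd _ gXd'; first by nia.
  exists (g ^+ ai.+1 - c *: f ^+ absz j), (i * (absz j)%:Z); split; [|exact: hc|].
    by rewrite mulrBr mulrBl fgX -scalerAr -scalerAl fX.
  have -> : (g ^+ ai.+1 - c *: f ^+ absz j) * h - h * (g ^+ ai.+1 - c *: f ^+ absz j)
    = g ^+ ai.+1 * h - h * g ^+ ai.+1.
    rewrite mulrBr mulrBl -scalerAr -scalerAl fXh opprB addrA.
    by rewrite subrK.
  by rewrite -dE intS; have -> : j * (1 + ai%:Z) - j + d = j * ai%:Z + d by ring.
(* Opposite signs, or j = 0, where the power of f is 1: the product has degree 0, and its top
   coefficient is a constant that can be removed. *)
have dE : j * ai.+1%:Z + i * (absz j)%:Z = 0 by rewrite -aiE; nia.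
have [p0 _] := has_degM (has_degX ai.+1 gj) (has_degX (absz j) fi).
rewrite dE in p0.
have fp : f * (g ^+ ai.+1 * f ^+ absz j) = (g ^+ ai.+1 * f ^+ absz j) * f.
  by rewrite mulrA fgX -!mulrA fX.
have [c hc] := commute_deg0 fp fi i0 p0.
exists (g ^+ ai.+1 * f ^+ absz j - c%:A), 0; split; [|exact: hc|].
  by rewrite mulrBr mulrBl fp -scalerAr -scalerAl mulr1 mul1r.
have -> : (g ^+ ai.+1 * f ^+ absz j - c%:A) * h - h * (g ^+ ai.+1 * f ^+ absz j - c%:A)
  = (g ^+ ai.+1 * h - h * g ^+ ai.+1) * f ^+ absz j.
  rewrite mulrBr mulrBl -scalerAr -scalerAl mulr1 mul1r opprB addrA.
  by rewrite subrK mulrBl -!mulrA fXh.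
have -> : 0 - j + d = j * ai%:Z + d + i * (absz j)%:Z.
  by move: dE; rewrite intS mulrDr; lia.
exact: has_degM gX (has_degX (absz j) fi).
Qed.

Lemma centralizer_comm_deg_neq0 f i : has_deg f i -> i != 0 ->
  forall g h, f * g = g * f -> f * h = h * f -> g * h = h * g.
Proof.
move=> fi i0 g h fg fh; apply/eqP; rewrite -subr_eq0; apply: contraT => nz.
have g0 : g != 0 by apply: contra_neq nz => ->; rewrite mul0r mulr0 subrr.
have h0 : h != 0 by apply: contra_neq nz => ->; rewrite mul0r mulr0 subrr.
have [d ghd] := has_deg_ex nz; have [j gj] := has_deg_ex g0.
have [l hl] := has_deg_ex h0; have [gj' _] := gj; have [hl' _] := hl.
have le := has_deg_le ghd (commutator_deg gj' hl').
have ee : j + l - d = (absz (j + l - d)%R)%:Z by lia.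
by case: (centralizer_no_bracket fi i0 fg fh gj hl ghd ee).
Qed.

Lemma centralizer_comm_deg0 f : dle f 0 -> fderiv (f 0) != 0 ->
  forall g h, f * g = g * f -> f * h = h * f -> g * h = h * g.
Proof.
move=> f0 nf.
have deg0 g : f * g = g * f -> g != 0 -> has_deg g 0.
  move=> fg /has_deg_ex[j gj]; have [gj' nz] := gj.
  have := commute_lead fg f0 gj'; rewrite !mul0r => /esym/eqP.
  rewrite mulf_eq0 (negPf nf) orbF mulf_eq0 (negPf nz) orbF => j0.
  have [je|jn] := eqVneq j 0; first by move: gj; rewrite je.
  exfalso; move: j0; apply/negP; exact: (intr_neq0 (charK_ratfun charK0) jn).
move=> g h fg fh; apply/eqP; rewrite -subr_eq0; apply: contraT => nz.
have g0 : g != 0 by apply: contra_neq nz => ->; rewrite mul0r mulr0 subrr.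
have h0 : h != 0 by apply: contra_neq nz => ->; rewrite mul0r mulr0 subrr.
have fgh : f * (g * h - h * g) = (g * h - h * g) * f.
  by rewrite mulrBr mulrBl !mulrA fg fh -!mulrA fg fh.
have [gd _] := deg0 g fg g0; have [hd _] := deg0 h fh h0.
by have := has_deg_le (deg0 _ fgh nz) (commutator_deg gd hd); lia.
Qed.

Theorem tilde_centralizer_comm f : (forall c : K, f <> c%:A) ->
  forall g h, f * g = g * f -> f * h = h * f -> g * h = h * g.
Proof.
move=> fK; have [n fn] : exists n, has_deg f n.
  by apply: has_deg_ex; apply/eqP => f0; apply: (fK 0); rewrite scale0r.
have [n0|] := eqVneq n 0; last exact: centralizer_comm_deg_neq0.
have [f0 _] := fn; rewrite n0 in f0.
have [f'0|] := eqVneq (fderiv (f 0)) 0; last first.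
  exact: centralizer_comm_deg0.
(* Degree 0 with a constant leading coefficient: subtracting that constant keeps the centralizer and
   makes the degree negative, which is the case of nonzero degree. *)
have [c e] := fderiv_eq0 charK0 f'0.
have h1 : dle (f - c%:A) (0 - 1).
  apply: deg_le_predB => //; first exact: deg_le_alg.
  by rewrite e tser_alg /mono eqxx.
have [m fm] : exists m, has_deg (f - c%:A) m.
  by apply: has_deg_ex; rewrite subr_eq0; apply/eqP/fK.
have comm g : f * g = g * f -> (f - c%:A) * g = g * (f - c%:A).
  by move=> fg; rewrite mulrBr mulrBl fg -scalerAr -scalerAl mulr1 mul1r.
have m0 : m != 0 by have := has_deg_le fm h1; lia.
by move=> g h /comm fg /comm fh; apply: (centralizer_comm_deg_neq0 fm m0).
Qed.

End TildeDegree.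

(** * Normally ordered elements of the Weyl algebra *)

Section WeylElements.
Variable K : fieldType.
Local Notation wpoly := {poly {poly K}}.

(** Left multiplication by q on normally ordered coefficients. The outer variable stands for p and
    the inner one for q, so q p^i = p^i q + i p^(i-1) becomes multiplication by the inner variable
    plus the derivative in the outer one. *)
Definition weyl_qmul (c : wpoly) : wpoly := 'X%:P * c + c^`().

(* [c], [d] and [weyl_star c d] hold the coefficients of the p^i q^j in two
   elements of the Weyl algebra and in their product. *)
Definition weyl_star (c d : wpoly) : wpoly :=
  \sum_(i < size c) 'X^i * \sum_(j < size c`_i) (c`_i`_j)%:P%:P * iter j weyl_qmul d.

(** * Evaluation at a pair satisfying the Weyl relation *)

Section Evaluation.
Variables (R : algType K) (p q : R).
Hypothesis qp : q * p - p * q = 1.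

(** The sum of [weyl_elt], in an algebra that need not carry an inverse, so that it also applies to
    the series ring. *)
Definition weyl (c : wpoly) : R :=
  \sum_(i < size c) \sum_(j < size c`_i) (c`_i`_j) *: (p ^+ i * q ^+ j).

Lemma horner_algE (c : {poly K}) :
  horner_alg q c = \sum_(j < size c) c`_j *: q ^+ j.
Proof.
rewrite /horner_alg /= /horner_morph horner_coef size_map_poly.
by apply: eq_bigr => j _; rewrite coef_map /= -scalerAl mul1r.
Qed.

Lemma weylE (c : wpoly) M : (size c <= M)%N ->
  weyl c = \sum_(i < M) p ^+ i * horner_alg q c`_i.
Proof.
move=> leM.
transitivity (\sum_(i < size c) p ^+ i * horner_alg q c`_i).
  apply: eq_bigr => i _; rewrite horner_algE mulr_sumr.
  by apply: eq_bigr => j _; rewrite scalerAr.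
rewrite (big_ord_widen _ (fun i => p ^+ i * horner_alg q c`_i) leM) big_mkcond.
apply: eq_bigr => i _; case: ltnP => // le.
by rewrite nth_default // rmorph0 mulr0.
Qed.

Lemma weylD c d : weyl (c + d) = weyl c + weyl d.
Proof.
pose M := maxn (size c) (size d).
rewrite !(@weylE _ M) ?leq_maxl ?leq_maxr ?size_polyD // -big_split.
by apply: eq_bigr => i _; rewrite coefD rmorphD mulrDr.
Qed.

Lemma weyl0 : weyl 0 = 0.
Proof. by rewrite /weyl size_poly0 big_ord0. Qed.

Lemma weyl_sum (I : Type) (s : seq I) (P : pred I) (E : I -> wpoly) :
  weyl (\sum_(i <- s | P i) E i) = \sum_(i <- s | P i) weyl (E i).
Proof. exact: (big_morph _ weylD weyl0). Qed.

Lemma weylCM k (c : wpoly) : weyl (k%:P%:P * c) = k *: weyl c.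
Proof.
have le : (size (k%:P%:P * c)%R <= size c)%N.
  by rewrite mul_polyC; exact: size_scale_leq.
rewrite (weylE le) (weylE (leqnn _)) scaler_sumr; apply: eq_bigr => i _.
by rewrite coefCM mul_polyC linearZ /= -scalerAl mul1r scalerAr.
Qed.

Lemma weylN c : weyl (- c) = - weyl c.
Proof. by have := weylCM (-1) c; rewrite !polyCN !polyC1 mulN1r scaleN1r. Qed.

Lemma weylXM (c : wpoly) : weyl ('X * c) = p * weyl c.
Proof.
have le : (size ('X * c)%R <= (size c).+1)%N.
  by rewrite mulrC (leq_trans (size_polyMleq _ _)) // size_polyX addn2.
rewrite (weylE le) (weylE (leqnn _)) big_ord_recl coefXM /= rmorph0 mulr0 add0r.
by rewrite mulr_sumr; apply: eq_bigr => i _; rewrite coefXM /= exprS mulrA.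
Qed.

Lemma weylXnM i (c : wpoly) : weyl ('X^i * c) = p ^+ i * weyl c.
Proof. by elim: i => [|i IHi]; rewrite ?mul1r // !exprS -!mulrA weylXM IHi. Qed.

Lemma horner_alg_comm (c : {poly K}) : q * horner_alg q c = horner_alg q ('X * c).
Proof. by rewrite rmorphM /= horner_algX. Qed.

Lemma weylYM c : weyl ('X%:P * c) = weyl c * q.
Proof.
have le : (size ('X%:P * c)%R <= size c)%N.
  by rewrite mul_polyC; exact: size_scale_leq.
rewrite (weylE le) (weylE (leqnn _)) mulr_suml; apply: eq_bigr => i _.
by rewrite coefCM mulrC rmorphM /= horner_algX mulrA.
Qed.

Lemma weyl_commX i : q * p ^+ i = p ^+ i * q + p ^+ i.-1 *+ i.
Proof.
elim: i => [|i IHi]; first by rewrite mulr1 mul1r mulr0n addr0.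
have qpE : q * p = p * q + 1 by rewrite -qp addrC subrK.
rewrite exprS mulrA qpE mulrDl mul1r -mulrA IHi mulrDr !mulrA -exprS.
rewrite mulrnAr -addrA; congr (_ + _).
case: i {IHi} => [|i]; first by rewrite mulr0n add0r.
by rewrite -exprS -mulrSr.
Qed.

Lemma weyl_qmulE c : weyl (weyl_qmul c) = q * weyl c.
Proof.
rewrite /weyl_qmul weylD weylYM.
rewrite (weylE (leqnn _)) (@weylE _ (size c)); last first.
  by have [->|c0] := eqVneq c 0; [rewrite deriv0 | exact: ltnW (lt_size_deriv c0)].
transitivity (\sum_(i < size c) (p ^+ i * q + p ^+ i.-1 *+ i) * horner_alg q c`_i).
  under [in RHS]eq_bigr do rewrite mulrDl.
  rewrite big_split mulr_suml /=; congr (_ + _).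
    apply: eq_bigr => i _; rewrite -!mulrA horner_alg_comm mulrC.
    by rewrite rmorphM /= horner_algX.
  case e: (size c) => [|M]; first by rewrite !big_ord0.
  rewrite [RHS]big_ord_recl mulr0n mul0r add0r big_ord_recr /=.
  rewrite coef_deriv (nth_default _ (eq_leq e)) mul0rn rmorph0 mulr0 addr0.
  by apply: eq_bigr => i _; rewrite coef_deriv rmorphMn /= mulrnAr mulrnAl.
rewrite mulr_sumr; apply: eq_bigr => i _.
by rewrite -weyl_commX mulrA.
Qed.

(** As [weyl_star] involves coefficients only, one computation gives products both in D and in the
    series ring. *)
Lemma weyl_starE c d : weyl (weyl_star c d) = weyl c * weyl d.
Proof.
rewrite weyl_sum {2}/weyl mulr_suml; apply: eq_bigr => i _.
rewrite weylXnM weyl_sum mulr_sumr mulr_suml; apply: eq_bigr => j _.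
rewrite weylCM -scalerAl -scalerAr; congr (_ *: _).
rewrite -mulrA; congr (_ * _).
elim: (j : nat) => [|k IHk]; first by rewrite mul1r.
by rewrite iterS weyl_qmulE IHk exprS mulrA.
Qed.

Lemma weylC k : weyl k%:P%:P = k%:A.
Proof.
rewrite (@weylE _ 1) ?size_polyC_leq1 // big_ord1 mul1r coefC /=.
by rewrite horner_algC.
Qed.

Lemma weyl1 : weyl 1 = 1.
Proof. by rewrite -polyC1 -polyC1 weylC scale1r. Qed.

End Evaluation.
End WeylElements.

(** * Embedding of the completion *)

Section CompletionEmbedding.
Variables (K : fieldType) (r0 s0 : int).
Hypothesis charK0 : [pchar K] =i pred0.
Hypothesis nu0_gt0 : 0 < r0 + s0.
Local Notation F := (ratfun K).
Local Notation "x %:F" := (tofrac x).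
Local Notation T := (tilde_ring charK0 nu0_gt0).
Local Notation wpoly := {poly {poly K}}.
Local Notation dle x n := (deg_le (tser x) n).

(** The series ring has its own parameters: [(r0, s0)] will be [(r, s)] if s is nonzero, and
    [(s, r)] otherwise. The hypothesis [lead_neq0] excludes cancellation among the top terms of a
    normally ordered sum, so that the degree of its image is its weight. *)
Variables (r s : int) (P Q : T).
Hypothesis QP : Q * P - P * Q = 1.
Hypotheses (P_deg : dle P r) (Q_deg : dle Q s).
Hypothesis lead_neq0 : forall (c : wpoly) n,
  (exists i j : nat, c`_i`_j != 0 /\ r * i%:Z + s * j%:Z = n) ->
  \sum_(i < size c) \sum_(j < size c`_i | r * i%:Z + s * j%:Z == n)
    ((c`_i`_j)%:P)%:F * (P r ^+ i * Q s ^+ j) != 0.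

Local Notation psi := (weyl P Q).

Lemma weyl_tilde_deg (c : wpoly) n :
  (forall i j : nat, c`_i`_j != 0 -> r * i%:Z + s * j%:Z <= n) ->
  (exists i j : nat, c`_i`_j != 0 /\ r * i%:Z + s * j%:Z = n) ->
  has_deg (psi c) n.
Proof.
move=> cn ex.
have PQ_deg i j : dle (P ^+ i * Q ^+ j) (r * i%:Z + s * j%:Z).
  exact: deg_leM (deg_leX P_deg) (deg_leX Q_deg).
split=> [k ltk|].
  rewrite tser_sum big1 // => i _; rewrite tser_sum big1 // => j _.
  rewrite tserZ; have [->|nz] := eqVneq (c`_i`_j) 0; first by rewrite tofrac0 mul0r.
  by rewrite PQ_deg ?mulr0 //; have := cn _ _ nz; lia.
rewrite (_ : tser (psi c) n = \sum_(i < size c)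
  \sum_(j < size c`_i | r * i%:Z + s * j%:Z == n)
    ((c`_i`_j)%:P)%:F * (P r ^+ i * Q s ^+ j)); first exact: (lead_neq0 ex).
rewrite tser_sum; apply: eq_bigr => i _; rewrite tser_sum [RHS]big_mkcond.
apply: eq_bigr => j _; rewrite tserZ; case: eqP => [<-|ne].
  by rewrite (lead_coefM (deg_leX P_deg) (deg_leX Q_deg)) !lead_coefX.
have [->|nz] := eqVneq (c`_i`_j) 0; first by rewrite tofrac0 mul0r.
by rewrite PQ_deg ?mulr0 //; have := cn _ _ nz; lia.
Qed.

(** * Embedding of the quotient division ring through right fractions *)

Hypothesis rs_gt0 : 0 < r + s.
Variables (D Dh : unitAlgType K) (p q : D) (v : D -> int).
Variables (iota : {lrmorphism D -> Dh}) (vh : Dh -> int).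
Hypotheses (D1 : is_D1 p q) (vrs : is_vrs r s p q v) (compl : is_completion v iota vh).

Local Notation W := (weyl p q).

Let qp : q * p - p * q = 1. Proof. by case: D1. Qed.

Let divD : division_ring D. Proof. by case: D1. Qed.

Lemma division_mulf_neq0 (E : unitRingType) (x y : E) :
  division_ring E -> x != 0 -> y != 0 -> x * y != 0.
Proof.
move=> dE x0 y0; apply: contra_neq y0 => xy0.
by rewrite -[y](mulKr (dE x x0)) xy0 mulr0.
Qed.

(* [v] is pinned down on [W c] for every [c != 0], so if [W c = 0] then [v 0] is
   the weight of [c], but also those of ['X * c] and ['X%:P * c], whence
   [r = s = 0]. *)
Lemma weyl_D_eq0 (c : wpoly) : W c = 0 -> c = 0.
Proof.
move=> Wc; apply/eqP; apply: contraT => c0; have [vW _] := vrs.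
have vC d : d != 0 -> W d = 0 ->
   (exists i j : nat, d`_i`_j != 0 /\ v 0 = r * i%:Z + s * j%:Z) /\
   (forall i j : nat, d`_i`_j != 0 -> r * i%:Z + s * j%:Z <= v 0).
  by move=> d0 Wd; have := vW d d0; rewrite -[weyl_elt p q d]/(W d) Wd.
have [[i [j [nz e]]] le] := vC c c0 Wc.
have r0' : r = 0.
  have Xc0 : 'X * c != 0 by rewrite mulf_neq0 ?polyX_eq0.
  have WXc : W ('X * c) = 0 by rewrite weylXM Wc mulr0.
  have [[i' [j' [+ h2]]] le'] := vC _ Xc0 WXc.
  rewrite coefXM; case: i' h2 => [|i'] h2 /=; first by rewrite coef0 eqxx.
  move=> /le h1; have := le' i.+1 j; rewrite coefXM /= => /(_ nz).
  by move: h1 h2 e; rewrite !intS !mulrDr !mulr1; lia.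
have s0' : s = 0.
  have Yc0 : 'X%:P * c != 0 by rewrite mulf_neq0 ?polyC_eq0 ?polyX_eq0.
  have WYc : W ('X%:P * c) = 0 by rewrite weylYM Wc mul0r.
  have [[i' [j' [+ h2]]] le'] := vC _ Yc0 WYc.
  rewrite coefCM coefXM; case: j' h2 => [|j'] h2 /=; first by rewrite eqxx.
  move=> /le h1; have := le' i j.+1; rewrite coefCM coefXM /= => /(_ nz).
  by move: h1 h2 e; rewrite !intS !mulrDr !mulr1; lia.
by move: rs_gt0; rewrite r0' s0'.
Qed.

Lemma weyl_D_inj : injective W.
Proof.
move=> c d e; apply/eqP; rewrite -subr_eq0; apply/eqP/weyl_D_eq0.
by rewrite weylD weylN e subrr.
Qed.

Lemma weyl_D_neq0 c : c != 0 -> W c != 0.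
Proof. by apply: contra_neq; exact: weyl_D_eq0. Qed.

Lemma psi_has_deg c : c != 0 -> has_deg (psi c) (v (W c)).
Proof.
move=> c0; have [/(_ c c0)[[i [j [nz e]]] le] _] := vrs.
by apply: weyl_tilde_deg => //; exists i, j.
Qed.

Lemma psi_neq0 c : c != 0 -> psi c != 0.
Proof. by move=> /psi_has_deg/has_deg_neq0. Qed.

(** An equality in D lifts to coefficients because [W] is injective, and then evaluates at [P],
    [Q]. *)
Lemma weyl_psi_transfer c d c' d' :
  W c * W d = W c' * W d' -> psi c * psi d = psi c' * psi d'.
Proof. by rewrite -!weyl_starE // => /weyl_D_inj ->. Qed.

(** The right Ore condition: the element d^-1 c of D is again a right fraction e e'^-1. *)
Lemma weyl_ore c d : d != 0 -> exists e e', e' != 0 /\ W d * W e = W c * W e'.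
Proof.
move=> d0; have [_ _ frac] := D1.
have [e [e' [We' E]]] := frac ((W d)^-1 * W c).
exists e, e'; split.
  by apply: contra_neq We' => ->; exact: weyl0.
have Ud := divD (weyl_D_neq0 d0); have Ue : W e' \is a GRing.unit by exact: divD.
by rewrite -[W c](mulVKr Ud) E -!mulrA mulVr // mulr1.
Qed.

(* [f] is the image of [x] under the embedding of D_1(K) into the series ring. *)
Definition D_rel (x : D) (f : T) :=
  exists c d, [/\ d != 0, x * W d = W c & f * psi d = psi c].

Lemma D_rel_total x : exists f, D_rel x f.
Proof.
have [_ _ /(_ x)[c [d [Wd E]]]] := D1.
have d0 : d != 0 by apply: contra_neq Wd => ->; exact: weyl0.
have [f fE] := tilde_divl (psi c) (psi_neq0 d0).
by exists f, c, d; split=> //; rewrite E divrK //; exact: divD.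
Qed.

Lemma D_relD x y f g : D_rel x f -> D_rel y g -> D_rel (x + y) (f + g).
Proof.
move=> [c [d [d0 xd fd]]] [c' [d' [d0' yd gd]]].
(* Common right denominator d e = d' e'. *)
have [e [e' [e0' E]]] := weyl_ore d' d0.
have E' := weyl_psi_transfer E.
exists (weyl_star c e + weyl_star c' e'), (weyl_star d e); split.
- have : W (weyl_star d e) != 0.
    rewrite weyl_starE // E.
    by apply: division_mulf_neq0 => //; exact: weyl_D_neq0.
  by apply: contra_neq => ->; exact: weyl0.
- by rewrite weylD !weyl_starE // mulrDl mulrA xd E mulrA yd.
by rewrite weylD !weyl_starE // mulrDl mulrA fd E' mulrA gd.
Qed.

Lemma D_relN x f : D_rel x f -> D_rel (- x) (- f).
Proof.
move=> [c [d [d0 xd fd]]]; exists (- c), d; split=> //.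
  by rewrite mulNr xd weylN.
by rewrite mulNr fd weylN.
Qed.

Lemma D_relM x y f g : D_rel x f -> D_rel y g -> D_rel (x * y) (f * g).
Proof.
move=> [c [d [d0 xd fd]]] [c' [d' [d0' yd gd]]].
(* From d e = c' e' the product is the fraction (c e) (d' e')^-1. *)
have [e [e' [e0' E]]] := weyl_ore c' d0.
have E' := weyl_psi_transfer E.
exists (weyl_star c e), (weyl_star d' e'); split.
- have : W (weyl_star d' e') != 0.
    rewrite weyl_starE //.
    by apply: division_mulf_neq0 => //; exact: weyl_D_neq0.
  by apply: contra_neq => ->; exact: weyl0.
- by rewrite !weyl_starE // -mulrA [y * _]mulrA yd -E mulrA xd.
by rewrite !weyl_starE // -mulrA [g * _]mulrA gd -E' mulrA fd.
Qed.

Lemma D_rel_alg (k : K) : D_rel k%:A k%:A.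
Proof.
exists k%:P%:P, 1; split; first exact: oner_neq0.
  by rewrite weyl1 weylC mulr1.
by rewrite weyl1 weylC mulr1.
Qed.

Lemma D_rel_deg x f : D_rel x f -> x != 0 -> has_deg f (v x).
Proof.
move=> [c [d [d0 xd fd]]] x0.
have Wc : W c != 0 by rewrite -xd division_mulf_neq0 // weyl_D_neq0.
have c0 : c != 0 by apply: contra_neq Wc => ->; exact: weyl0.
have pc := psi_has_deg c0; have pd := psi_has_deg d0.
have f0 : f != 0.
  apply/eqP => f0; move: (psi_neq0 c0).
  by rewrite -fd f0 mul0r eqxx.
have [m fm] := has_deg_ex f0.
have vx : v x = v (W c) - v (W d).
  have [_ /(_ c d Wc (weyl_D_neq0 d0)) <-] := vrs; congr v.
  by rewrite -[weyl_elt _ _ c]/(W c) -xd mulrK //; exact: (divD (weyl_D_neq0 d0)).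
have := has_degM fm pd; rewrite fd => /(has_deg_uniq pc) e.
by have -> : v x = m by rewrite vx e; lia.
Qed.

Lemma D_rel0 f : D_rel 0 f -> f = 0.
Proof.
move=> [c [d [d0 + fd]]]; rewrite mul0r => /esym/weyl_D_eq0 c0.
apply: (tilde_mulIf (psi_neq0 d0)).
by rewrite fd c0 weyl0 mul0r.
Qed.

(** * The degree map of the completion *)

Let vh_deg : is_degree vh. Proof. by case: compl. Qed.
Let vh_iota x : x != 0 -> vh (iota x) = v x. Proof. by case: compl => _ _ /(_ x). Qed.

Lemma degree_opp (x : Dh) : x != 0 -> vh (- x) = vh x.
Proof.
move=> x0; have [vM _] := vh_deg.
have n1 : (-1 : Dh) != 0 by rewrite oppr_eq0 oner_eq0.
(* Twice the degree of -1 is the degree of 1, which is 0 since it equals its own double. *)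
have := vM _ _ n1 n1; rewrite mulrNN mulr1.
have := vM _ _ (oner_neq0 Dh) (oner_neq0 Dh); rewrite mulr1.
have := vM _ _ n1 x0; rewrite mulN1r.
by move: (vh (- x)) (vh (- 1)) (vh 1) (vh x) => a b c d -> h1 h2; lia.
Qed.

Lemma v_ltD (x y : Dh) N : v_lt vh x N -> v_lt vh y N -> v_lt vh (x + y) N.
Proof.
have [_ vD] := vh_deg.
have [-> _|x0 [/eqP|xN]] := eqVneq x 0; first by rewrite add0r.
  by rewrite (negPf x0).
have [->|y0 [/eqP|yN]] := eqVneq y 0; first by rewrite addr0; right.
  by rewrite (negPf y0).
have [->|xy0] := eqVneq (x + y) 0; first by left.
by right; apply: le_lt_trans (vD x y x0 y0 xy0) _; rewrite gt_max xN yN.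
Qed.

Lemma v_ltN (x : Dh) N : v_lt vh x N -> v_lt vh (- x) N.
Proof.
have [->|x0 [/eqP|xN]] := eqVneq x 0; first by rewrite oppr0.
  by rewrite (negPf x0).
by right; rewrite degree_opp.
Qed.

Lemma v_lt_mono (x : Dh) M N : M <= N -> v_lt vh x M -> v_lt vh x N.
Proof. by move=> le [->|lt]; [left | right; lia]. Qed.

Lemma v_ltM (x y : Dh) M N : v_lt vh x M -> v_lt vh y N -> v_lt vh (x * y) (M + N).
Proof.
have [vM _] := vh_deg.
have [->|x0 [/eqP|xN]] := eqVneq x 0; first by rewrite mul0r; left.
  by rewrite (negPf x0).
have [->|y0 [/eqP|yN]] := eqVneq y 0; first by rewrite mulr0; left.
  by rewrite (negPf y0).
by right; rewrite vM // ltrD.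
Qed.

Lemma v_lt_ex (x : Dh) : exists N, v_lt vh x N.
Proof. by exists (vh x + 1); right; lia. Qed.

Let iota_neq0 x : x != 0 -> iota x != 0.
Proof.
move=> x0; apply/eqP => ix; have := congr1 iota (divrr (divD x0)).
by rewrite rmorphM /= ix mul0r rmorph1 => /esym/eqP; rewrite oner_eq0.
Qed.

Lemma D_rel_v_lt x f N : D_rel x f -> v_lt vh (iota x) N -> dle f (N - 1).
Proof.
have [-> /D_rel0 -> _ i _|x0 xf] := eqVneq x 0; first by rewrite tser0.
have [fv _] := D_rel_deg xf x0; case=> [/eqP|lt].
  by rewrite (negPf (iota_neq0 x0)).
by apply: deg_le_mono fv; rewrite -vh_iota //; lia.
Qed.

Lemma D_rel_v_lt_inv x f N : D_rel x f -> dle f (N - 1) -> v_lt vh (iota x) N.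
Proof.
have [-> _ _|x0 xf fN] := eqVneq x 0; first by left; rewrite raddf0.
by right; rewrite vh_iota //; have := has_deg_le (D_rel_deg xf x0) fN; lia.
Qed.

(** The extension by continuity of the embedding of D, as a relation: [x] and [f] are approximated
    to every precision by an element of D and its image. No choice of fraction or sequence has to be
    proved irrelevant. *)
Definition Dh_rel (x : Dh) (f : T) := forall N : int,
  exists x0 f0, [/\ D_rel x0 f0, v_lt vh (x - iota x0) N & dle (f - f0) (N - 1)].

Lemma Dh_relD x y f g : Dh_rel x f -> Dh_rel y g -> Dh_rel (x + y) (f + g).
Proof.
move=> xf yg N; have [x0 [f0 [h1 h2 h3]]] := xf N; have [y0 [g0 [h4 h5 h6]]] := yg N.
exists (x0 + y0), (f0 + g0); split; first exact: D_relD.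
  by rewrite raddfD opprD addrACA; exact: v_ltD.
by rewrite opprD addrACA; exact: deg_leD.
Qed.

Lemma Dh_relN x f : Dh_rel x f -> Dh_rel (- x) (- f).
Proof.
move=> xf N; have [x0 [f0 [h1 h2 h3]]] := xf N.
exists (- x0), (- f0); split; first exact: D_relN.
  by rewrite raddfN -opprD; exact: v_ltN.
by rewrite -opprD; exact: deg_leN.
Qed.

Lemma Dh_relM x y f g : Dh_rel x f -> Dh_rel y g -> Dh_rel (x * y) (f * g).
Proof.
move=> xf yg N.
have [B1 xB] := v_lt_ex x; have [B2 yB] := v_lt_ex y.
have [B3 fB] := deg_le_ex f; have [B4 gB] := deg_le_ex g.
(* [B] bounds all four factors. The precision [M] satisfies M + B <= N, for the error terms, and M
   <= B, so that the approximants are bounded by [B] too. *)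
pose B := Num.max (Num.max B1 B2) (Num.max (B3 + 1) (B4 + 1)).
pose M := Num.min B (N - B).
have {}xB : v_lt vh x B by apply: v_lt_mono xB; rewrite /B; lia.
have {}yB : v_lt vh y B by apply: v_lt_mono yB; rewrite /B; lia.
have {}fB : dle f (B - 1) by apply: deg_le_mono fB; rewrite /B; lia.
have {}gB : dle g (B - 1) by apply: deg_le_mono gB; rewrite /B; lia.
have leMB : M <= B by rewrite /M; lia.
have leMN : M + B <= N by rewrite /M; lia.
have [x0 [f0 [h1 h2 h3]]] := xf M; have [y0 [g0 [h4 h5 h6]]] := yg M.
exists (x0 * y0), (f0 * g0); split; first exact: D_relM.
  have -> : x * y - iota (x0 * y0) = (x - iota x0) * y + iota x0 * (y - iota y0).
    by rewrite rmorphM mulrBl mulrBr addrA subrK.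
  have x0B : v_lt vh (iota x0) B.
    rewrite -[iota x0](subKr x); apply: v_ltD => //.
    by apply: v_ltN; apply: v_lt_mono h2.
  apply: v_ltD; first by apply: v_lt_mono (v_ltM h2 yB).
  by apply: v_lt_mono (v_ltM x0B h5); rewrite addrC.
have -> : f * g - f0 * g0 = (f - f0) * g + f0 * (g - g0).
  by rewrite mulrBl mulrBr addrA subrK.
have f0B : dle f0 (B - 1).
  rewrite -[f0](subKr f); apply: deg_leB => //.
  by apply: deg_le_mono h3; lia.
apply: deg_leD; first by apply: deg_le_mono (deg_leM h3 gB); lia.
by apply: deg_le_mono (deg_leM f0B h6); lia.
Qed.

Lemma Dh_rel_alg (k : K) : Dh_rel k%:A k%:A.
Proof.
move=> N; exists k%:A, k%:A; split; first exact: D_rel_alg.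
  by left; rewrite linearZ /= rmorph1 subrr.
by rewrite subrr => i _; rewrite tser0.
Qed.

(** With additivity, this makes the relation single-valued, and [Dh_rel0r] makes it injective. *)
Lemma Dh_rel0l f : Dh_rel 0 f -> f = 0.
Proof.
move=> xf; apply: deg_le_all => n; have [x0 [f0 [h1 h2 h3]]] := xf (n + 1).
rewrite -(subrK f0 f); apply: deg_leD; first by apply: deg_le_mono h3; lia.
have : v_lt vh (iota x0) (n + 1).
  by move: h2; rewrite sub0r => /v_ltN; rewrite opprK.
by move/(D_rel_v_lt h1); apply: deg_le_mono; lia.
Qed.

Lemma Dh_rel0r x : Dh_rel x 0 -> x = 0.
Proof.
move=> xf; apply/eqP; apply: contraT => nz.
(* At precision [vh x] the approximation would give x a degree below its own. *)
have [x0 [f0 [h1 h2 h3]]] := xf (vh x).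
have : v_lt vh x (vh x); last by case=> [/eqP|]; rewrite ?(negPf nz) ?ltxx.
rewrite -{1}(subrK (iota x0) x); apply: v_ltD => //.
apply: (D_rel_v_lt_inv h1); rewrite -[f0]opprK; apply: deg_leN.
by move: h3; rewrite sub0r.
Qed.

(** Approximants of x in D have images whose successive differences fall in degree, since the
    embedding preserves degrees; the image of x is their limit in the series ring. *)
Lemma Dh_rel_total x : exists f, Dh_rel x f.
Proof.
have dense : forall k : nat, exists xf : D * T,
    D_rel xf.1 xf.2 /\ v_lt vh (x - iota xf.1) (- k%:Z).
  move=> k; have [_ _ _ /(_ x (- k%:Z))[x0 h] _] := compl.
  by have [f0 h0] := D_rel_total x0; exists (x0, f0).
have [u uP] := choice dense.
have [k|l hl] := tilde_complete (u := fun k => (u k).2) (A := 0).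
  rewrite sub0r; have [h1 h2] := uP k; have [h3 h4] := uP k.+1.
  have h5 := D_relD h3 (D_relN h1).
  have : v_lt vh (iota ((u k.+1).1 - (u k).1)) (- k%:Z).
    have -> : iota ((u k.+1).1 - (u k).1) =
        (x - iota (u k).1) - (x - iota (u k.+1).1).
      by rewrite raddfB opprB [RHS]addrC addrA subrK.
    apply: v_ltD => //; apply: v_ltN; apply: v_lt_mono h4; lia.
  by move/(D_rel_v_lt h5); apply: deg_le_mono; lia.
exists l => N; pose k := (absz N).+1; have [h1 h2] := uP k.
exists (u k).1, (u k).2; split=> //; first by apply: v_lt_mono h2; rewrite /k; lia.
by apply: deg_le_mono (hl k); rewrite /k; lia.
Qed.

Hypothesis s0_neq0 : s0 != 0.

Theorem completion_ccc : ccc [set: Dh]%classic (fun x y : Dh => x * y).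
Proof.
split=> [comm|z _ zNc x y [_ zx] [_ zy]].
  have := comm (iota q) (iota p) I I => e.
  have := congr1 iota qp; rewrite /= rmorphB !rmorphM /= rmorph1 e subrr => /eqP.
  by rewrite eq_sym oner_eq0.
have [f zf] := Dh_rel_total z; have [g xg] := Dh_rel_total x.
have [h yh] := Dh_rel_total y.
have inj a b a' b' : Dh_rel a a' -> Dh_rel b b' -> a = b -> a' = b'.
  move=> aa bb e; apply/eqP; rewrite -subr_eq0; apply/eqP/Dh_rel0l.
  by rewrite -(subrr a) {2}e; exact: Dh_relD aa (Dh_relN bb).
have inj' a b a' : Dh_rel a a' -> Dh_rel b a' -> a = b.
  move=> aa bb; apply/eqP; rewrite -subr_eq0; apply/eqP/Dh_rel0r.
  by rewrite -(subrr a'); exact: Dh_relD aa (Dh_relN bb).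
have fg := inj _ _ _ _ (Dh_relM zf xg) (Dh_relM xg zf) zx.
have fh := inj _ _ _ _ (Dh_relM zf yh) (Dh_relM yh zf) zy.
(* By injectivity an element with constant image is that constant, hence central. *)
have fK (k : K) : f <> k%:A.
  move=> e; apply: zNc; split=> // w _; rewrite e in zf.
  by rewrite (inj' _ _ _ zf (Dh_rel_alg k)) -scalerAl -scalerAr mul1r mulr1.
have gh := tilde_centralizer_comm s0_neq0 fK fg fh.
by apply: (inj' _ _ (g * h)); [exact: Dh_relM | rewrite gh; exact: Dh_relM].
Qed.

End CompletionEmbedding.

(** * Conclusion *)

Lemma ccc_op (X : Type) (A : set X) (mul : X -> X -> X) :
  ccc A (fun x y => mul y x) -> ccc A mul.
Proof.
move=> [nc cc]; split=> [c|x Ax xc y z [Ay xy] [Az xz]].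
  by apply: nc => y z Ay Az; rewrite c.
have xc' : ~ alg_center A (fun x y => mul y x) x.
  by move=> [_ h]; apply: xc; split=> // w Aw; rewrite -h.
by apply/esym; apply: (cc x Ax xc').
Qed.

Lemma check_mulE (K : fieldType) (r s : int) (f g : series K) :
  check_mul r s f g = tilde_mul s r g f.
Proof.
apply/funext => n; rewrite /check_mul /tilde_mul.
rewrite (reindex_fsbig (fun t : int * int * nat => (t.1.2, t.1.1, t.2))
  [set t | t.1.1 + t.1.2 - t.2%:Z * (s + r) = n]%classic
  [set t | t.1.1 + t.1.2 - t.2%:Z * (r + s) = n]%classic).
  by apply: eq_fsbigr => -[[i j] k] _ /=; rewrite [r + s]addrC mulrAC.
split.
- by move=> [[i j] k] /= <-; rewrite [r + s]addrC [i + j]addrC.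
- by move=> [[i j] k] [[i' j'] k'] _ _ /= [-> -> ->].
move=> [[i j] k] /= <-; exists (j, i, k) => //=.
by rewrite [r + s]addrC [i + j]addrC.
Qed.

(** * Monomials and subsets of the series ring *)

Section TildeSubalgebras.
Variables (K : fieldType) (r s : int).
Hypothesis charK0 : [pchar K] =i pred0.
Hypothesis nu_gt0 : 0 < r + s.
Local Notation F := (ratfun K).
Local Notation "x %:F" := (tofrac x).
Local Notation T := (tilde_ring charK0 nu_gt0).

Lemma tilde_mul_mono_linear i j (a b : F) n : fderiv (fderiv b) = 0 ->
  tilde_mul r s (mono i a) (mono j b) n =
  mono (i + j) (a * b) n +
  mono (i + j - (r + s)) (comm_coef F (r + s) s i 1 * a * fderiv b) n.
Proof.
move=> b''; pose N := (absz (i + j - n)%R).+2.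
have hN : i + j - n < N%:Z by lia.
rewrite (tilde_mulE nu_gt0 (mono_deg_le _) (mono_deg_le _) hN).
transitivity (\sum_(k < N) comm_coef F (r + s) s i k * a *
    fderivn k (mono j b (n + k%:Z * (r + s) - i))).
  apply: eq_bigr => k _; rewrite big_ord_recl big1 => [|e _].
    by rewrite !subr0 !addr0 /mono eqxx.
  rewrite {1}/mono ifF ?mulr0 ?mul0r //; apply/eqP; rewrite lift0; lia.
rewrite big_ord_recl big_ord_recl big1 ?addr0 => [|k _]; last first.
  rewrite !lift0 /fderivn !iterSr /mono; case: eqP => _; last first.
    by rewrite !fderiv0 [iter _ _ _]fderivn0 mulr0.
  by rewrite b'' [iter _ _ _]fderivn0 mulr0.
rewrite !lift0 /fderivn /=; congr (_ + _).
  rewrite comm_coef0 mul1r mul0r addr0 /mono.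
  have -> : (n - i == j) = (n == i + j) by rewrite subr_eq addrC.
  by case: eqP => _; rewrite ?mulr0.
rewrite mul1r /mono.
have -> : (n + (r + s) - i == j) = (n == i + j - (r + s)).
  by apply/eqP/eqP; lia.
by case: eqP => _; rewrite ?fderiv0 ?mulr0.
Qed.

Hypothesis s_neq0 : s != 0.

Lemma tilde_mul_T_alpha i j :
  tilde_mul r s (mono i 1) (mono j (alpha K)) =
  mono (i + j) (alpha K) + mono (i + j - (r + s)) (i%:~R / s%:~R).
Proof.
apply/funext => n; rewrite tilde_mul_mono_linear; last first.
  by rewrite fderiv_alpha fderiv1.
rewrite (comm_coef1 (charK_ratfun charK0) _ (lt0r_neq0 nu_gt0) s_neq0).
by rewrite fderiv_alpha !mulr1 mul1r.
Qed.

Lemma tilde_mul_alpha_T i j :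
  tilde_mul r s (mono i (alpha K)) (mono j 1) = mono (i + j) (alpha K).
Proof.
apply/funext => n; rewrite tilde_mul_mono_linear; last by rewrite fderiv1 fderiv0.
rewrite fderiv1 mulr0 mulr1 [X in _ + X](_ : _ = 0) ?addr0 //.
by rewrite /mono; case: eqP.
Qed.

Lemma mono_neq0 i (a : F) : a != 0 -> mono i a <> 0.
Proof. by move=> a0 /(congr1 (@^~ i)); rewrite /mono eqxx => /eqP; apply/negP. Qed.

(** The difference of the two products is the monomial of degree i + j - nu with coefficient i /
    s. *)
Lemma T_alpha_not_commute i j : i != 0 ->
  tilde_mul r s (mono i 1) (mono j (alpha K)) <>
  tilde_mul r s (mono j (alpha K)) (mono i 1).
Proof.
move=> i0; rewrite tilde_mul_T_alpha tilde_mul_alpha_T [j + i]addrC.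
rewrite -[X in _ <> X]addr0 => /addrI; apply: mono_neq0.
have cF := charK_ratfun charK0.
exact: (mulf_neq0 (intr_neq0 cF i0) (invr_neq0 (intr_neq0 cF s_neq0))).
Qed.

(** Centralizers in [A] lie in those of the whole ring, and constants commute with every series, so
    an element noncentral in [A] is not constant. *)
Lemma tilde_subalgebra_ccc (A : set (series K)) :
  (forall f, A f -> laurent f) ->
  (exists f g, [/\ A f, A g & tilde_mul r s f g <> tilde_mul r s g f]) ->
  ccc A (tilde_mul r s).
Proof.
move=> AL [f0 [g0 [Af0 Ag0 nc]]]; split=> [comm|f Af fc g h [Ag fg] [Ah fh]].
  exact: nc (comm _ _ Af0 Ag0).
pose toT f (Af : A f) : T := exist _ f (AL f Af).
have fK (c : K) : toT f Af <> c%:A.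
  move=> e; have {}e : f = mono 0 (c%:P)%:F.
    by rewrite -(tser_alg charK0 nu_gt0) -e.
  apply: fc; split=> // y Ay; rewrite e.
  rewrite (tilde_mulCl charK0 nu_gt0 c (AL y Ay)).
  by rewrite (tilde_mulCr nu_gt0 c (AL y Ay)).
have fgT : toT f Af * toT g Ag = toT g Ag * toT f Af by apply: tser_inj.
have fhT : toT f Af * toT h Ah = toT h Ah * toT f Af by apply: tser_inj.
have ghT := tilde_centralizer_comm s_neq0 fK fgT fhT.
exact: (congr1 (fun x : T => tser x) ghT).
Qed.

End TildeSubalgebras.

Lemma deg_closure_A1 (K : fieldType) mul (p q f : series K) :
  (forall f, laurent f -> mul f (mono 0 1) = f) ->
  laurent f -> A1_image mul p q f -> deg_closure (D1_image mul p q) f.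
Proof.
move=> mul1 lf Af; split=> // N; exists f; last first.
  by move=> i _; exact: subrr.
split=> //; exists f, (mono 0 1); split=> //; last exact: mul1.
  by have := A1_const mul p q 1; rewrite polyC1 tofrac1.
by apply: mono_neq0; exact: oner_neq0.
Qed.

(** [P] will select the pairs on a line r i + s j = n, where the exponents [e i j] are distinct. The
    monomials are then independent, as the coefficient at [e i0 j0] shows. *)
Lemma line_poly_neq0 (K : fieldType) (c : {poly {poly K}})
    (P : nat -> nat -> bool) (e : nat -> nat -> nat) (u : nat -> nat -> K) i0 j0 :
  (forall i j, u i j != 0) ->
  (forall i j i' j', P i j -> P i' j' -> e i j = e i' j' -> i = i' /\ j = j') ->
  P i0 j0 -> c`_i0`_j0 != 0 ->
  \sum_(i < size c) \sum_(j < size c`_i | P i j)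
     (c`_i`_j)%:P * (u i j *: 'X^(e i j)) != 0 :> {poly K}.
Proof.
move=> u0 e_inj P0 c0; apply/eqP => /(congr1 (fun f : {poly K} => f`_(e i0 j0))).
have lt_i : (i0 < size c)%N.
  by rewrite ltnNge; apply: contra c0 => le; rewrite (nth_default _ le) coef0.
have lt_j : (j0 < size (c`_i0)%R)%N.
  by rewrite ltnNge; apply: contra c0 => le; rewrite (nth_default _ le).
rewrite coef0 coef_sum (bigD1 (Ordinal lt_i)) //= [X in _ + X]big1 => [|i ne].
  rewrite addr0 coef_sum (bigD1 (Ordinal lt_j)) //= big1 => [|j /andP[Pj ne]].
    rewrite addr0 coefCM coefZ coefXn eqxx mulr1 => /eqP.
    by rewrite mulf_eq0 (negPf c0) (negPf (u0 _ _)).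
  rewrite coefCM coefZ coefXn; case: eqP => [/(e_inj _ _ _ _ P0 Pj)[_ E]|_].
    by move: ne; rewrite -val_eqE /= E eqxx.
  by rewrite !mulr0.
rewrite coef_sum big1 // => j Pj.
rewrite coefCM coefZ coefXn; case: eqP => [/(e_inj _ _ _ _ P0 Pj)[E _]|_].
  by move: ne; rewrite -val_eqE /= E eqxx.
by rewrite !mulr0.
Qed.

Lemma line_sum_neq0 (K : fieldType) (c : {poly {poly K}})
    (P : nat -> nat -> bool) (A : nat -> nat -> ratfun K)
    (e : nat -> nat -> nat) (u : nat -> nat -> K) :
  (forall i j, A i j = tofrac (u i j *: 'X^(e i j))) ->
  (forall i j, u i j != 0) ->
  (forall i j i' j', P i j -> P i' j' -> e i j = e i' j' -> i = i' /\ j = j') ->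
  (exists i j, c`_i`_j != 0 /\ P i j) ->
  \sum_(i < size c) \sum_(j < size c`_i | P i j) tofrac (c`_i`_j)%:P * A i j != 0.
Proof.
move=> AE u0 e_inj [i0 [j0 [c0 P0]]].
have -> : \sum_(i < size c) \sum_(j < size c`_i | P i j) tofrac (c`_i`_j)%:P * A i j
  = tofrac (\sum_(i < size c) \sum_(j < size c`_i | P i j)
      (c`_i`_j)%:P * (u i j *: 'X^(e i j))).
  rewrite rmorph_sum; apply: eq_bigr => i _; rewrite rmorph_sum.
  by apply: eq_bigr => j _; rewrite AE; exact: (esym (tofracM _ _)).
by rewrite tofrac_eq0; exact: (line_poly_neq0 u0 e_inj P0 c0).
Qed.

Theorem corollary6p2 (K : closedFieldType) (charK0 : [pchar K] =i pred0)
    (r s : int) (nu_gt0 : 0 < r + s) :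
  (s != 0 -> ccc (@laurent K) (tilde_mul r s)) /\
  (r != 0 -> ccc (@laurent K) (check_mul r s)) /\
  (forall (D Dh : unitAlgType K) (p q : D) (v : D -> int)
      (iota : {lrmorphism D -> Dh}) (vh : Dh -> int),
     is_D1 p q -> is_vrs r s p q v -> is_completion v iota vh ->
     ccc [set: Dh] (fun x y : Dh => x * y)) /\
  (s != 0 -> ccc (@hat_in_tilde K r s) (tilde_mul r s)) /\
  (r != 0 -> ccc (@hat_in_check K r s) (check_mul r s)).
Proof.
have nu_gt0' : 0 < s + r by rewrite addrC.
have checkE : check_mul r s = (fun f g : series K => tilde_mul s r g f).
  by apply/funext => f; apply/funext => g; exact: check_mulE.
have mulr1 r' s' : 0 < r' + s' ->
    forall f : series K, laurent f -> tilde_mul r' s' f (mono 0 1) = f.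
  move=> h f lf; have := tilde_mulCr h 1 lf; rewrite polyC1 tofrac1 => ->.
  by apply/funext => n; rewrite mul1r.
have mul1r r' s' : 0 < r' + s' ->
    forall f : series K, laurent f -> tilde_mul r' s' (mono 0 1) f = f.
  move=> h f lf; have := tilde_mulCl charK0 h 1 lf; rewrite polyC1 tofrac1 => ->.
  by apply/funext => n; rewrite mul1r.
split; [|split; [|split; [|split]]].
- move=> s0; apply: tilde_subalgebra_ccc => //.
  exists (mono s 1), (mono r (alpha K)); split; try exact: mono_laurent.
  exact: T_alpha_not_commute.
- move=> r0; rewrite checkE; apply: ccc_op => /=.
  apply: (tilde_subalgebra_ccc charK0 nu_gt0' r0) => //.
  exists (mono r 1), (mono s (alpha K)); split; try exact: mono_laurent.
  exact: T_alpha_not_commute.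
- move=> D Dh p q v iota vh D1 vrs compl.
  have [s0|s0] := eqVneq s 0; last first.
    pose P := tmono charK0 nu_gt0 r (alpha K); pose Q := tmono charK0 nu_gt0 s 1.
    apply: (completion_ccc (P := P) (Q := Q) _ _ _ _ nu_gt0 D1 vrs compl s0).
    + apply/tser_inj/funext => n; rewrite tserB !tserM.
      rewrite [tser P]/(mono r (alpha K)) [tser Q]/(mono s 1).
      rewrite (tilde_mul_T_alpha charK0 nu_gt0 s0) (tilde_mul_alpha_T K nu_gt0).
      rewrite divff ?(intr_neq0 (charK_ratfun charK0)) // [s + r]addrC subrr.
      by rewrite -[(_ + mono 0 1) n]/(mono (r + s) (alpha K) n + mono 0 1 n) addrC addKr.
    + exact: mono_deg_le.
    + exact: mono_deg_le.
    move=> c n [i0 [j0 [c0 e0]]].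
    rewrite [tser P r](_ : _ = tofrac 'X); last by rewrite /tser /= /mono eqxx.
    rewrite [tser Q s](_ : _ = 1); last by rewrite /tser /= /mono eqxx.
    (* The top coefficient of P^i Q^j is alpha^i, and i determines j on the line because s is
       nonzero. *)
    apply: (@line_sum_neq0 K c (fun i j : nat => r * i%:Z + s * j%:Z == n)
      (fun i j => tofrac 'X ^+ i * 1 ^+ j) (fun i _ => i) (fun _ _ => 1)).
    + by move=> i j; rewrite expr1n GRing.mulr1 scale1r tofracXn.
    + by move=> _ _; exact: oner_neq0.
    + move=> i j i' j' /eqP e /eqP e' ii; split=> //; move: e e'; rewrite ii => <-.
      by move=> /addrI/(mulfI s0) [].
    by exists i0, j0; rewrite e0 eqxx.
  have r0 : r != 0 by apply: contraTneq nu_gt0 => ->; rewrite s0.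
  (* For s = 0 the roles of r and s are exchanged. This series ring is the opposite of the one with
     [check_mul], and the sign in [Q] restores the relation QP - PQ = 1. *)
  pose P := tmono charK0 nu_gt0' r 1.
  pose Q := - tmono charK0 nu_gt0' s (alpha K).
  apply: (completion_ccc (P := P) (Q := Q) _ _ _ _ nu_gt0 D1 vrs compl r0).
  + rewrite mulNr mulrN opprK addrC.
    apply/tser_inj/funext => n; rewrite tserB !tserM.
    rewrite [tser P]/(mono r 1) [tser (tmono _ _ _ _)]/(mono s (alpha K)).
    rewrite (tilde_mul_T_alpha charK0 nu_gt0' r0) (tilde_mul_alpha_T K nu_gt0').
    rewrite divff ?(intr_neq0 (charK_ratfun charK0)) // [r + s]addrC subrr.
    by rewrite -[(_ + mono 0 1) n]/(mono (s + r) (alpha K) n + mono 0 1 n) addrC addKr.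
  + exact: mono_deg_le.
  + by apply: deg_leN; exact: mono_deg_le.
  move=> c n [i0 [j0 [c0 e0]]].
  rewrite [tser P r](_ : _ = 1); last by rewrite /tser /= /mono eqxx.
  rewrite [tser Q s](_ : _ = tofrac (- 'X)); last first.
    by rewrite tserN /tser /= /mono eqxx tofracN.
  (* The top coefficient is now (- alpha)^j, and j determines i because r is nonzero. *)
  apply: (@line_sum_neq0 K c (fun i j : nat => r * i%:Z + s * j%:Z == n)
    (fun i j => 1 ^+ i * tofrac (- 'X) ^+ j) (fun _ j => j) (fun _ j => (-1) ^+ j)).
  + move=> i j; rewrite expr1n GRing.mul1r -tofracXn -mul_polyC.
    by rewrite polyC_exp polyCN polyC1 -exprNn.
  + by move=> _ j; rewrite signr_eq0.
  + move=> i j i' j' /eqP e /eqP e' jj; split=> //; move: e e'; rewrite jj => <-.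
    by move=> /addIr/(mulfI r0) [].
  by exists i0, j0; rewrite e0 eqxx.
- move=> s0; apply: (tilde_subalgebra_ccc charK0 nu_gt0 s0); first by move=> f [].
  exists (mono s 1), (mono r (alpha K)); split; last exact: T_alpha_not_commute.
    by apply: deg_closure_A1; [exact: mulr1 | exact: mono_laurent | exact: A1_q].
  by apply: deg_closure_A1; [exact: mulr1 | exact: mono_laurent | exact: A1_p].
move=> r0; rewrite checkE; apply: ccc_op => /=.
apply: (tilde_subalgebra_ccc charK0 nu_gt0' r0); first by move=> f [].
exists (mono r 1), (mono s (alpha K)); split; last exact: T_alpha_not_commute.
  rewrite /hat_in_check checkE.
  by apply: deg_closure_A1; [exact: mul1r | exact: mono_laurent | exact: A1_p].
rewrite /hat_in_check checkE.
by apply: deg_closure_A1; [exact: mul1r | exact: mono_laurent | exact: A1_q].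
Qed.
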